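(* Let $p\in\{1,2\}$ and $q\in\{0,1,2\}$. For any $D\ge2$ there exist finitely generated torsion groups $G_1,G_2,\ldots,G_D$, with $G:=\prod_{j=1}^DG_j$ infinite, such that the following holds. Let $\mu_i$ be finitely supported symmetric non-degenerate probability measures on $G_i$ with $\mu_i(e)>0$ ($i=1,\ldots,D$), and put $\mu=\prod_{i=1}^D\mu_i$ (the product measure on $G$). Then for each $j=1,\ldots,D$ there exists a non-principal ultrafilter $U$ on $\mathbb{N}$ such that the limiting cocycle $b^{p,q}_{\mu,U}$ factors through the projection $G\twoheadrightarrow G_j$.
   Context: Let $G$ be an infinite group generated by a finite set $S$, and let $\mu$ be a finitely supported probability measure on $G$. A measure is non-degenerate if its support generates the group, and symmetric if $\mu(g)=\mu(g^{-1})$. $\mu^{*n}$ denotes the $n$-th convolution power, regarded as a function on $G$; $(\mu^{*n})^q$ is its pointwise $q$-th power, with the convention $0^0=0$ (so for $q=0$ it is the indicator function of the support of $\mu^{*n}$). For a function $f$ on $G$ and $g\in G$, $gf$ denotes the left translate $(gf)(x)=f(g^{-1}x)$. For a non-principal ultrafilter $U$ on $\mathbb{N}$, $\ell_p(G)^U$ is the ultrapower $\ell_\infty(\mathbb{N};\ell_p(G))/\{(v_n)_n:\lim_U\|v_n\|_p=0\}$ and $[v_n]_n$ is the class of $(v_n)_n$. Put $\alpha^{p,q}(n)=\max_{s\in S}\|(\mu^{*n})^q-s(\mu^{*n})^q\|_p$ and \[ b^{p,q}_{\mu,U}\colon G\to\ell_p(G)^U,\qquad b^{p,q}_{\mu,U}(g)=\bigl[\alpha^{p,q}(n)^{-1}\bigl((\mu^{*n})^q-g(\mu^{*n})^q\bigr)\bigr]_n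 . \] ''Whether it factors through a quotient'' does not depend on the choice of $S$. The map $b^{p,q}_{\mu,U}$ factors through $G\twoheadrightarrow G_j$ if $b^{p,q}_{\mu,U}(g)$ depends only on the image of $g$ in $G_j$. *)

(* Defs.v *)
From HB Require Import structures.
From mathcomp Require Import all_boot all_order all_algebra.
From mathcomp Require Import finmap.
From mathcomp Require Import all_classical all_reals all_analysis.
Set Implicit Arguments.
Unset Strict Implicit.
Unset Printing Implicit Defensive.
Import Order.TTheory GRing.Theory Num.Theory.
Import numFieldNormedType.Exports.
Local Open Scope classical_set_scope.
Local Open Scope ring_scope.

Definition generates (G : groupType) (A : {pred G}) : Prop :=
  forall H : {pred G}, group_closed H -> {subset A <= H} -> forall g, g \in H.

Definition finitely_generated (G : groupType) : Prop :=
  exists S : seq G, generates [in S].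

Definition torsion (G : groupType) : Prop :=
  forall g : G, exists2 n : nat, (0 < n)%N & (g ^+ n = 1)%g.

Definition prod_group (I : finType) (G : I -> groupType) : Type :=
  {dffun forall i : I, G i}.

Section ProdGroup.
Context (I : finType) (G : I -> groupType).
Local Open Scope group_scope.
Implicit Types g h : prod_group G.

HB.instance Definition _ := Choice.on (prod_group G).

Let one : prod_group G := [ffun i => 1].
Let inv g : prod_group G := [ffun i => (g i)^-1].
Let mul g h : prod_group G := [ffun i => g i * h i].

Let mulA : associative mul.
Proof. by move=> f g h; apply/ffunP => i; rewrite !ffunE mulgA. Qed.
Let mul1 : left_id one mul.
Proof. by move=> g; apply/ffunP => i; rewrite !ffunE mul1g. Qed.
Let mulr1 : right_id one mul.
Proof. by move=> g; apply/ffunP => i; rewrite !ffunE mulg1. Qed.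
Let mulV : left_inverse one inv mul.
Proof. by move=> g; apply/ffunP => i; rewrite !ffunE mulVg. Qed.
Let mulrV : right_inverse one inv mul.
Proof. by move=> g; apply/ffunP => i; rewrite !ffunE mulgV. Qed.

HB.instance Definition _ :=
  isGroup.Build (prod_group G) mulA mul1 mulr1 mulV mulrV.

Lemma prod_group1E i : (1 : prod_group G) i = 1. Proof. by rewrite ffunE. Qed.
Lemma prod_groupME g h i : (g * h) i = g i * h i. Proof. by rewrite ffunE. Qed.
Lemma prod_groupVE g i : g^-1 i = (g i)^-1. Proof. by rewrite ffunE. Qed.

End ProdGroup.

(* G with the sigma-algebra of all its subsets, so that L^p of the counting
   measure makes sense on it. *)
Definition discrete (T : Type) : Type := T.

Section Discrete.
Context (G : groupType).

HB.instance Definition _ := Group.on (discrete G).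
HB.instance Definition _ := isPointed.Build (discrete G) 1%g.
HB.instance Definition _ := @isMeasurable.Build default_measure_display
  (discrete G) discrete_measurable discrete_measurable0
  discrete_measurableC discrete_measurableU.
End Discrete.

Section Counting.
Context (R : realType) (G : groupType).
Local Notation T := (discrete G).
Local Notation mu := (@counting T R).
Implicit Types (A : set T) (g : T).

Lemma integral_counting_fin A (h : T -> \bar R) : finite_set A ->
  (forall x, 0 <= h x)%E -> (forall x, ~ A x -> h x = 0%E) ->
  (\int[mu]_x h x = \sum_(x \in A) h x)%E.
Proof.
move=> finA h0 hA.
rewrite [LHS](_ : _ =
    \int[mu]_t \sum_(x \in A) (h x * (\1_[set x] t)%:E))%E; last first.
  apply: eq_integral => t _; have [At|nAt] := pselect (A t).
    rewrite (fsbigD1 t)//= indicE mem_set// mule1 fsbig1 ?adde0// => x [Ax xt].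
    by rewrite indicE memNset ?mule0// => tx; apply: xt.
  rewrite hA// fsbig1// => x Ax; rewrite indicE memNset ?mule0//= => tx.
  by apply: nAt; rewrite tx.
rewrite ge0_integral_fsum//; last first.
  by move=> x t _; apply: mule_ge0.
apply: eq_fsbigr => x _.
rewrite ge0_integralZl// integral_indic// setIT /= /counting asboolT//.
by rewrite fset_set1 cardfs1 mule1.
Qed.

Lemma counting_translate g A : mu ((fun x : T => (g * x)%g) @^-1` A) = mu A.
Proof.
have inj : injective (fun x : T => (g * x)%g) by move=> x y /mulgI.
have imK : (fun x : T => (g * x)%g) @` ((fun x : T => (g * x)%g) @^-1` A) = A.
  apply/seteqP; split => [_ [x Ax <-]//|x Ax].
  by exists (g^-1 * x)%g; rewrite /= mulgA mulgV mul1g.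
rewrite /counting; case: asboolP => finA.
  rewrite -[in RHS]imK asboolT; last exact: finite_image.
  by rewrite fset_set_image// card_imfset.
rewrite asboolF// => fA; apply: finA; apply: finite_preimage => //.
by move=> x y _ _ /inj.
Qed.

Lemma integral_translate g (h : T -> \bar R) : (forall x, 0 <= h x)%E ->
  (\int[mu]_x h (g * x)%g = \int[mu]_x h x)%E.
Proof.
move=> h0.
have mg : measurable_fun [set: T] (fun x : T => (g * x)%g) by [].
rewrite [RHS](eq_measure_integral (pushforward mu (fun x : T => (g * x)%g))).
  by rewrite ge0_integral_pushforward.
by move=> A _ _; rewrite -[LHS](counting_translate g).
Qed.
End Counting.

(* The real space l_p(G).  The only null set of the counting measure is empty,
   so no quotient by almost everywhere equality is needed: see the normed
   structure below. *)
Definition lp (R : realType) (G : groupType) (p : R) (p1 : (1 <= p%:E)%E) :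
    Type :=
  LfunType (@counting (discrete G) R) p1.

Section Lp.
Context (R : realType) (G : groupType) (p : R) (p1 : (1 <= p%:E)%E).
Local Notation T := (discrete G).
Local Notation mu := (@counting T R).

HB.instance Definition _ := GRing.Lmodule.on (lp G p1).

Definition lp_norm (v : lp G p1) : R := fine ('N[mu]_(p%:E)[EFin \o v])%E.

Let normD (v w : lp G p1) : lp_norm (v + w) <= lp_norm v + lp_norm w.
Proof. exact: ler_LnormD. Qed.
Let norm0 (v : lp G p1) : lp_norm v = 0 -> v = 0.
Proof.
move=> /fine_Lnormr_eq0 [N [_ N0 sub]]; apply/LfuneqP => x.
apply: contrapT => vx; have Nx : N x by apply: sub => h; apply: vx; exact: h.
have NE : N = set0.
  move: N0; rewrite /= /counting; case: asboolP => // finN /eqP.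
  rewrite eqe pnatr_eq0 cardfs_eq0 => /eqP N0.
  by rewrite -(fset_setK finN) N0 set_fset0.
by rewrite NE in Nx.
Qed.
Let normMn (v : lp G p1) n : lp_norm (v *+ n) = lp_norm v *+ n.
Proof. exact: Lnormr_natmul. Qed.
Let normN (v : lp G p1) : lp_norm (- v) = lp_norm v.
Proof. exact: LnormrN. Qed.

HB.instance Definition _ :=
  Num.Zmodule_isNormed.Build R (lp G p1) normD norm0 normMn normN.

Lemma lp_normZ (a : R) (v : lp G p1) : `|a *: v| = `|a| * `|v|.
Proof.
rewrite [LHS]/(lp_norm _) [in RHS]/(@Num.norm _ (lp G p1) _) /= /lp_norm.
by rewrite (LnormZ v a) fineM// -finite_norm_fine.
Qed.

Lemma Lnorm_translate (g : T) (f : T -> R) :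
  ('N[mu]_(p%:E)[EFin \o (fun x => f (g * x)%g)] = 'N[mu]_(p%:E)[EFin \o f])%E.
Proof.
rewrite unlock /Lnorm; congr (_ `^ _)%E.
exact: (integral_translate g (fun x => poweR_ge0 `|(f x)%:E|%E p)).
Qed.

Lemma translate_subproof (g : G) (v : lp G p1) :
  (fun x : T => v (g^-1 * x)%g) \in Lfun mu p%:E.
Proof.
rewrite inE; apply/andP; split; rewrite inE//=.
by rewrite /finite_norm Lnorm_translate; exact: Lfunction_finite.
Qed.

Definition translate (g : G) (v : lp G p1) : lp G p1 :=
  Lfun_Sub p1 (translate_subproof g v).

Lemma translateE g v x : translate g v x = v (g^-1 * x)%g.
Proof. by []. Qed.

Lemma norm_translate g v : `|translate g v| = `|v|.
Proof. by congr fine; exact: Lnorm_translate. Qed.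

Lemma translateB g v w : translate g (v - w) = translate g v - translate g w.
Proof. exact/LfuneqP. Qed.

Lemma translate1 v : translate 1%g v = v.
Proof. by apply/LfuneqP => x; rewrite translateE invg1 mul1g. Qed.

Lemma translateM g h v : translate (g * h)%g v = translate g (translate h v).
Proof. by apply/LfuneqP => x; rewrite !translateE invgM mulgA. Qed.

Lemma Lnorm_fin (f : T -> R) (A : set T) : finite_set A ->
  (forall x, ~ A x -> f x = 0) ->
  'N[mu]_(p%:E)[EFin \o f]%E = ((\sum_(x \in A) `|f x| `^ p) `^ p^-1)%:E.
Proof.
move=> finA fA; rewrite unlock /Lnorm -poweR_EFin; congr (_ `^ _)%E.
rewrite (@integral_counting_fin _ _ A)//.
- by rewrite -fsumEFin.
- by move=> x; exact: poweR_ge0.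
- move=> x /fA fx; rewrite /= fx normr0 powR0// gt_eqF//.
  by rewrite (lt_le_trans ltr01)// -lee_fin.
Qed.

Lemma lp_fin_subproof (f : G -> R) : finite_set [set x | f x != 0] ->
  (f : T -> R) \in Lfun mu p%:E.
Proof.
move=> finf; rewrite inE; apply/andP; split; rewrite inE//=.
rewrite /finite_norm (Lnorm_fin finf) ?ltry// => x.
by move=> /negP; rewrite negbK => /eqP.
Qed.

Definition lp_fin (f : G -> R) (finf : finite_set [set x | f x != 0]) :
    lp G p1 :=
  Lfun_Sub p1 (lp_fin_subproof finf).

Lemma lp_finE f (finf : finite_set [set x | f x != 0]) x : lp_fin finf x = f x.
Proof. by []. Qed.

Lemma lp_norm_fin (v : lp G p1) (A : set T) : finite_set A ->
  (forall x, ~ A x -> v x = 0) ->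
  `|v| = (\sum_(x \in A) `|v x| `^ p) `^ p^-1.
Proof.
by move=> finA vA; rewrite [LHS]/(lp_norm v) /lp_norm (Lnorm_fin finA vA).
Qed.

End Lp.

Definition nonprincipal (T : Type) (U : set_system T) : Prop :=
  forall x, ~ U [set x].

Section Ultrapower.
Context (R : realType) (V : normedZmodType R).

Definition bounded_seq : {pred (nat -> V)} :=
  fun v => `[< exists M : R, forall n, `|v n| <= M >].

Let bounded_seq_zmod_closed : zmod_closed bounded_seq.
Proof.
split; first by apply/asboolP; exists 0 => n; rewrite normr0.
move=> v w /asboolP[M vM] /asboolP[N wN]; apply/asboolP; exists (M + N) => n.
by rewrite (le_trans (ler_normB _ _))// lerD.
Qed.

HB.instance Definition _ :=
  GRing.isZmodClosed.Build (nat -> V) bounded_seq bounded_seq_zmod_closed.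

(* The bounded sequences l_oo(N; V). *)
Record linf := Linf { linf_seq :> nat -> V; _ : linf_seq \in bounded_seq }.

HB.instance Definition _ := [isSub for linf_seq].
HB.instance Definition _ := [Choice of linf by <:].
HB.instance Definition _ := [SubChoice_isSubZmodule of linf by <:].

Context (U : set_system nat) {UU : UltraFilter U}.

Definition null_seq : {pred linf} :=
  fun v => `[< (fun n => `|v n|) @ U --> (0 : R) >].

Let null_seq_zmod_closed : zmod_closed null_seq.
Proof.
split.
  apply/asboolP; rewrite (_ : (fun _ => _) = cst 0); first exact: cvg_cst.
  by apply/funext => n; rewrite normr0.
move=> v w /asboolP v0 /asboolP w0; apply/asboolP.
apply: (@squeeze_cvgr _ _ _ _ (cst 0) (fun n => `|v n| + `|w n|)).
- by apply: nearW => n; rewrite normr_ge0 ler_normB.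
- exact: cvg_cst.
- by rewrite -[0 in X in _ --> X]addr0; exact: cvgD.
Qed.

HB.instance Definition _ :=
  GRing.isZmodClosed.Build linf null_seq null_seq_zmod_closed.

(* l_oo(N; V) / {v | lim_U |v_n| = 0}, as a quotient of abelian groups. *)
Definition ultrapower : Type := Quotient.quot null_seq.

Definition ultraclass (v : linf) : ultrapower :=
  \pi_(Quotient.quot null_seq)%qT v.

Lemma ultraclass_eq (v w : linf) :
  ultraclass v = ultraclass w <-> (fun n => `|v n - w n|) @ U --> (0 : R).
Proof.
rewrite /ultraclass; split.
  by move=> /eqP; rewrite -Quotient.idealrBE => /asboolP.
by move=> h; apply/eqP; rewrite -Quotient.idealrBE; apply/asboolP.
Qed.

End Ultrapower.
Arguments ultrapower {R} V U {UU}.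
Arguments ultraclass {R V} U {UU} v.

Section FinProb.
Context (R : realType) (G : groupType).

(* A finitely supported probability measure, given by its mass function. *)
Record finprob := FinProb {
  pmf :> G -> R;
  pmf_ge0 : forall g, 0 <= pmf g;
  pmf_fin : finite_set [set g | pmf g != 0];
  pmf_sum1 : \sum_(g \in [set: G]) pmf g = 1
}.

Definition symmetric_prob (mu : finprob) : Prop :=
  forall g : G, mu g = mu g^-1%g.

Definition nondegenerate_prob (mu : finprob) : Prop :=
  generates [pred g | mu g != 0].

(* The sum is over the finite set of y where the summand is nonzero; it is the
   usual convolution as soon as f or h is finitely supported. *)
Definition convolution (f h : G -> R) : G -> R :=
  fun x => \sum_(y \in [set: G]) f y * h (y^-1 * x)%g.

Definition convolution_pow (f : G -> R) (n : nat) : G -> R :=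
  iter n (convolution f) (fun x => (x == 1%g)%:R).

(* The pointwise q-th power with the convention 0 ^ 0 = 0 (in MathComp
   0 ^+ 0 = 1). *)
Definition pow0 (q : nat) (f : G -> R) : G -> R :=
  fun x => if f x == 0 then 0 else f x ^+ q.

Lemma convolution_fin (f h : G -> R) : finite_set [set x | f x != 0] ->
  finite_set [set x | h x != 0] -> finite_set [set x | convolution f h x != 0].
Proof.
move=> finf finh; have := finite_image2 (fun x y => x * y)%g finf finh.
apply: sub_finite_set => x /=; apply: contra_neqP => nx.
rewrite /convolution fsbig1// => y _; apply/eqP; rewrite mulf_eq0.
apply: contra_notT nx; rewrite negb_or => /andP[fy hy].
by exists y => //; exists (y^-1 * x)%g => //; rewrite mulgA mulgV mul1g.
Qed.

Lemma convolution_pow_fin (f : G -> R) n : finite_set [set x | f x != 0] ->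
  finite_set [set x | convolution_pow f n x != 0].
Proof.
move=> finf; elim: n => [|n IHn]; last exact: convolution_fin.
apply: (sub_finite_set _ (finite_set1 (1%g : G))) => x /=.
by case: (x =P 1%g) => // _; rewrite mulr0n eqxx.
Qed.

Lemma pow0_fin q (f : G -> R) : finite_set [set x | f x != 0] ->
  finite_set [set x | pow0 q f x != 0].
Proof.
apply: sub_finite_set => x; rewrite /= /pow0.
by case: (eqVneq (f x) 0) => // _; rewrite eqxx.
Qed.

End FinProb.

Section Cocycle.
Context (R : realType) (p : R) (p1 : (1 <= p%:E)%E) (q : nat).
Context (G : groupType) (mu : finprob R G).

(* (mu^{*n})^q *)
Definition convolution_powq (n : nat) : lp G p1 :=
  lp_fin p1 (pow0_fin q (convolution_pow_fin n (pmf_fin mu))).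

(* The norms are nonnegative, so starting the maximum at 0 is harmless. *)
Definition alpha (S : seq G) (n : nat) : R :=
  \big[Num.max/0]_(s <- S)
    `|convolution_powq n - translate s (convolution_powq n)|.

Definition cocycle_seq (S : seq G) (g : G) : nat -> lp G p1 :=
  fun n => (alpha S n)^-1 *:
    (convolution_powq n - translate g (convolution_powq n)).

Lemma alpha_ge0 S n : 0 <= alpha S n.
Proof.
by rewrite /alpha; elim/big_ind: _ => // x y x0 y0; rewrite le_max x0.
Qed.

Lemma cocycle_seq_bounded (S : seq G) : generates [in S] ->
  forall g, cocycle_seq S g \in @bounded_seq R (lp G p1).
Proof.
move=> genS.
pose d g n := `|convolution_powq n - translate g (convolution_powq n)|.
have alpha_max s n (S' : seq G) : s \in S' -> d s n <= alpha S' n.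
  elim: S' => // t S' IHS; rewrite inE /alpha big_cons le_max.
  by case/predU1P => [->|/IHS sS]; apply/orP; [left|right].
pose H : {pred G} := fun g =>
  `[< exists2 M : R, 0 <= M & forall n, d g n <= M * alpha S n >].
have dM g h n : d (g * h)%g n <= d g n + d h n.
  rewrite /d translateM -[X in `|X|](subrKA (translate g (convolution_powq n))).
  by rewrite (le_trans (ler_normD _ _))// lerD2l -translateB norm_translate.
have dV g n : d g^-1%g n = d g n.
  rewrite /d -(norm_translate g) translateB -translateM mulgV translate1.
  by rewrite distrC.
suff HT : forall g, g \in H.
  move=> g; have /asboolP[M M0 gM] := HT g; apply/asboolP; exists M => n.
  rewrite lp_normZ normfV ger0_norm ?alpha_ge0//.
  have [a0|a0] := eqVneq (alpha S n) 0; first by rewrite a0 invr0 mul0r.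
  by rewrite mulrC ler_pdivrMr ?gM// lt0r a0 alpha_ge0.
apply: genS => [|s sS]; last first.
  by apply/asboolP; exists 1 => // n; rewrite mul1r alpha_max.
split.
  apply/asboolP; exists 0 => // n.
  by rewrite mul0r /d translate1 subrr normr0.
move=> g h /asboolP[M M0 gM] /asboolP[N N0 hN]; apply/asboolP.
exists (M + N); first exact: addr_ge0.
by move=> n; rewrite mulrDl (le_trans (dM _ _ _))// dV lerD.
Qed.

(* b^{p,q}_{mu,U} *)
Definition limit_cocycle (S : seq G) (genS : generates [in S])
    (U : set_system nat) {UU : UltraFilter U} (g : G) :
    ultrapower (lp G p1) U :=
  ultraclass U (Linf (cocycle_seq_bounded genS g)).

End Cocycle.
Arguments limit_cocycle {R p} p1 q {G} mu {S} genS U {UU} g.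

Definition factors_through (A B C : Type) (b : A -> C) (f : A -> B) : Prop :=
  forall x y, f x = f y -> b x = b y.

Section ProdProb.
Context (R : realType) (I : finType) (G : I -> groupType).
Context (mu : forall i, finprob R (G i)).

Definition prod_pmf (g : prod_group G) : R := \prod_i mu i (g i).

Let s i : seq (G i) := fset_set [set x | mu i x != 0].
Let memS i x : (x \in s i) = (mu i x != 0).
Proof. by rewrite /s in_fset_set ?mem_setE//; exact: pmf_fin. Qed.
Let N := (\max_i size (s i)).+1.
Let phi (k : {ffun I -> 'I_N}) : prod_group G :=
  [ffun i => nth 1%g (s i) (k i)].
Let Q i (k : 'I_N) := (k < size (s i))%N.

Let supE (g : prod_group G) :
  prod_pmf g != 0 -> exists2 k, k \in family Q & phi k = g.
Proof.
move=> /prodf_neq0 g0.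
have lt i : (index (g i) (s i) < N)%N.
  by rewrite ltnS (leq_trans (index_size _ _))// (leq_bigmax i).
exists [ffun i => Ordinal (lt i)].
  by apply/familyP => i; rewrite ffunE unfold_in /Q /= index_mem memS g0.
by apply/ffunP => i; rewrite !ffunE /= nth_index// memS g0.
Qed.

Let phi_inj : {in family Q &, injective phi}.
Proof.
move=> k l /familyP kQ /familyP lQ /ffunP kl; apply/ffunP => i.
apply/val_inj/eqP.
have := kl i; rewrite !ffunE => /eqP; rewrite nth_uniq//.
- exact: kQ.
- exact: lQ.
- exact: fset_uniq.
Qed.

Let prod_ge0 g : 0 <= prod_pmf g.
Proof. by apply: prodr_ge0 => i _; exact: pmf_ge0. Qed.

Let prod_fin : finite_set [set g | prod_pmf g != 0].
Proof.
apply: (sub_finite_set (B := phi @` setT)); last first.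
  exact/finite_image/finite_finset.
by move=> g /supE[k _ <-]; exists k.
Qed.

Let prod_sum1 : \sum_(g \in [set: prod_group G]) prod_pmf g = 1.
Proof.
transitivity (\sum_(g \in phi @` [set` family Q]) prod_pmf g).
  apply/esym/fsbig_widen => // g [_ /= ng]; apply/eqP; apply: contra_notT ng.
  by move=> /supE[k kQ <-]; exists k.
rewrite fsbig_image; last by move=> k l /[!inE] kQ lQ; exact: phi_inj.
rewrite (@fsbigE _ _ _ _ _ (enum (family Q))) ?enum_uniq//; last 2 first.
  by move=> k; rewrite /= mem_enum.
  by move=> k kQ; rewrite mem_enum => /negP.
rewrite big_enum_cond/= (eq_bigl [in family Q]); last first.
  by move=> k; rewrite mem_setE andbb.
transitivity (\prod_i \sum_(k < N | Q i k) mu i (nth 1%g (s i) k)).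
  rewrite bigA_distr_big_dep; apply: eq_bigr => k _.
  by apply: eq_bigr => i _; rewrite ffunE.
apply: big1 => i _; rewrite -(pmf_sum1 (mu i)).
rewrite (@fsbigE _ _ _ _ _ (s i)) ?fset_uniq//; last first.
  by move=> x _; rewrite memS negbK => /eqP.
rewrite (eq_bigl xpredT); last by move=> x; rewrite in_setT.
rewrite [RHS](big_nth 1%g) big_mkord.
rewrite (big_ord_widen_cond N xpredT (fun k => mu i (nth 1%g (s i) k))) //.
by rewrite leqW// (leq_bigmax i).
Qed.

Definition prod_prob : finprob R (prod_group G) :=
  FinProb prod_ge0 prod_fin prod_sum1.

End ProdProb.

(* Main.v *)
(* The groups are built from the Grigorchuk recursion b = (a,c), c = (a,d),
   d = (1,b), which turns an action of Z/2 * (Z/2)^2 on a finite set X into one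
   on {0,1} x X.  Iterating it i times on any X gives an action that looks like
   the Grigorchuk group up to a radius depending on i, while for X a large ball
   in a tree on which Z/2 * (Z/2)^2 plays ping-pong, it satisfies an l1
   isoperimetric inequality with a constant depending only on i.  G_j is the
   diagonal product of such actions, of heights i_k tending to infinity, over the
   stages k = j mod D.  It is torsion because the sections of a word get shorter,
   uniformly in X.  At stage k, after i_k is chosen, one picks a time N_k so large
   that the groups G_i with i <> j, which look on that scale like a finite
   extension of a group of subexponential growth, have at most exp (eps_k N_k)
   elements in the ball reached by the random walks; the radius of the tree is
   then chosen larger than that ball.

   For every q and p the relative displacement of (mu_j^n)^q in l_p is thus at
   least a constant c_k for all n <= N_k, by the isoperimetric inequality applied
   to (mu_j^n)^(pq).  For i <> j, the displacement of (mu_i^n)^q is controlled by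
   the increment between n and n+1 of a potential (the logarithm of the size of
   the support, of the sum of the r-th powers, or the entropy) that is bounded by
   the logarithm of the size of the ball, so it is much smaller than c_k for some
   n in [k, N_k].  Along such times the cocycle is negligible on every factor
   other than G_j. *)
Require Import Defs.
From HB Require Import structures.
From mathcomp Require Import all_boot all_order all_algebra.
From mathcomp Require Import all_fingroup.
From mathcomp Require Import finmap zify ring lra.
From mathcomp Require Import all_classical all_reals all_analysis.
Set Implicit Arguments.
Unset Strict Implicit.
Unset Printing Implicit Defensive.
Import Order.TTheory GRing.Theory Num.Theory.
Import numFieldNormedType.Exports.
Local Open Scope classical_set_scope.
Local Open Scope ring_scope.

(** * Words and the Grigorchuk recursion *)

Definition klein4 : Type := (bool * bool)%type.
HB.instance Definition _ := Finite.on klein4.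

Definition v0 : klein4 := (false, false).
Definition vadd (v1 v2 : klein4) : klein4 := (v1.1 (+) v2.1, v1.2 (+) v2.2).

(* With b = (1,0), c = (1,1), d = (0,1) this is the 3-cycle b -> c -> d -> b. *)
Definition tau (v : klein4) : klein4 := (v.1 (+) v.2, v.1).

Lemma vaddvv v : vadd v v = v0.
Proof. by rewrite /vadd !addbb. Qed.

Lemma vaddA : associative vadd.
Proof. by move=> u v w; rewrite /vadd /= !addbA. Qed.

Lemma tauD v1 v2 : tau (vadd v1 v2) = vadd (tau v1) (tau v2).
Proof. by case: v1 v2 => [[] []] [[] []]. Qed.

(* [None] is the letter a. *)
Definition letter : Type := option klein4.
HB.instance Definition _ := Finite.on letter.
Notation word := (seq letter).

Record kaction := KAction {
  kcar :> finType;
  kflip : kcar -> kcar;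
  kact : klein4 -> kcar -> kcar;
  kflipK : involutive kflip;
  kact0 : forall x, kact v0 x = x;
  kactD : forall v1 v2 x, kact v1 (kact v2 x) = kact (vadd v1 v2) x }.

Definition lact (X : kaction) (s : letter) : X -> X :=
  if s is Some v then kact v else @kflip X.

Lemma lactK (X : kaction) (s : letter) : involutive (@lact X s).
Proof.
case: s => [v|] x /=; last exact: kflipK.
by rewrite kactD vaddvv kact0.
Qed.

(** Words act from the right, first letter first, which matches the product of permutations in
    [wperm_cat]. *)
Definition wact (X : kaction) (w : word) (x : X) : X :=
  foldl (fun y s => lact s y) x w.

Arguments wact : simpl never.

Lemma wact_cons (X : kaction) s w (x : X) : wact (s :: w) x = wact w (lact s x).
Proof. by []. Qed.

Lemma wact_cat (X : kaction) (u w : word) (x : X) :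
  wact (u ++ w) x = wact w (wact u x).
Proof. by rewrite /wact foldl_cat. Qed.

Lemma wact_rcons (X : kaction) (w : word) s (x : X) :
  wact (rcons w s) x = lact s (wact w x).
Proof. by rewrite -cats1 wact_cat. Qed.

Lemma wact_revK (X : kaction) (w : word) : cancel (@wact X w) (@wact X (rev w)).
Proof.
elim: w => // s w IHw x.
by rewrite rev_cons wact_rcons [wact (s :: w) x]/(wact w (lact s x)) IHw lactK.
Qed.

Lemma wact_inj (X : kaction) (w : word) : injective (@wact X w).
Proof. exact: can_inj (wact_revK w). Qed.

Definition kunit : kaction :=
  @KAction unit id (fun=> id) (fun=> erefl) (fun=> erefl) (fun _ _ _ => erefl).

Section Double.
Context (X : kaction).

Definition dflip (y : bool * X) : bool * X := (~~ y.1, y.2).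
Definition dkact (v : klein4) (y : bool * X) : bool * X :=
  (y.1, if y.1 then kact (tau v) y.2 else if v.1 then kflip y.2 else y.2).

Fact dflipK : involutive dflip.
Proof. by case=> e x; rewrite /dflip negbK. Qed.
Fact dkact0 y : dkact v0 y = y.
Proof. by case: y => [[] x] //; rewrite /dkact /= kact0. Qed.
Fact dkactD v1 v2 y : dkact v1 (dkact v2 y) = dkact (vadd v1 v2) y.
Proof.
case: y => [[] x]; rewrite /dkact /=; first by rewrite kactD tauD.
by case: v1 v2 => [[] ?] [[] ?] //=; rewrite kflipK.
Qed.

(* One step of the Grigorchuk recursion b = (a,c), c = (a,d), d = (1,b). *)
Definition kdouble : kaction := KAction dflipK dkact0 dkactD.
End Double.

Definition tower (i : nat) (X : kaction) : kaction := iter i kdouble X.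

(** The section of [w] at the vertex [e]: what [w] does to the second coordinate when the first one
    starts at [e]. *)
Fixpoint sec (e : bool) (w : word) : word :=
  match w with
  | [::] => [::]
  | None :: w' => sec (~~ e) w'
  | Some v :: w' =>
      (if e then [:: Some (tau v)] else if v.1 then [:: None] else [::])
        ++ sec e w'
  end.

Definition aodd (w : word) : bool := odd (count_mem None w).

Lemma aodd_cat u w : aodd (u ++ w) = aodd u (+) aodd w.
Proof. by rewrite /aodd count_cat oddD. Qed.

Lemma sec_cat e u w : sec e (u ++ w) = sec e u ++ sec (e (+) aodd u) w.
Proof.
elim: u e => [|[v|] u IHu] e /=; first by rewrite /aodd addbF.
- by rewrite IHu catA.
- by rewrite IHu /aodd /= addbN addNb.
Qed.

Lemma wact_double (X : kaction) w e (x : X) :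
  @wact (kdouble X) w (e, x) = (e (+) aodd w, wact (sec e w) x).
Proof.
elim: w e x => [|[v|] w IHw] e x; first by rewrite /aodd addbF.
- apply: (etrans (IHw e _)); rewrite /aodd /= add0n wact_cat.
  by case: e; case: (v.1).
- by apply: (etrans (IHw (~~ e) _)); rewrite /aodd /= addbN addNb.
Qed.

(** Quantifying over every base action [X] makes the torsion and growth bounds independent of the
    trees, whose radii are chosen after them. *)
Definition eqlev (r : nat) (u w : word) : Prop :=
  forall (X : kaction) i, (r <= i)%N -> @wact (tower i X) u =1 @wact (tower i X) w.

Lemma eqlev_sym r u w : eqlev r u w -> eqlev r w u.
Proof. by move=> uw X i ri x; rewrite uw. Qed.

Lemma eqlev_trans r u u1 w : eqlev r u u1 -> eqlev r u1 w -> eqlev r u w.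
Proof. by move=> uv vw X i ri x; rewrite uv// vw. Qed.

Lemma eqlev_leq r s u w : (r <= s)%N -> eqlev r u w -> eqlev s u w.
Proof. by move=> rs uw X i si x; rewrite uw// (leq_trans rs). Qed.

Lemma eqlev_cat r u u' w w' :
  eqlev r u u' -> eqlev r w w' -> eqlev r (u ++ w) (u' ++ w').
Proof. by move=> uu' ww' X i ri x; rewrite !wact_cat uu'// ww'. Qed.

Lemma eqlev_double r u w : aodd u = aodd w ->
  (forall e, eqlev r (sec e u) (sec e w)) -> eqlev r.+1 u w.
Proof.
move=> uw secuw X [//|i] ri [e x].
by rewrite !wact_double uw secuw.
Qed.

(** * Weights, normal forms and contraction of sections *)

Definition vwt (v : klein4) : nat :=
  match v with
  | (false, false) => 0 | (true, false) => 6 | (true, true) => 4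
  | (false, true) => 2
  end.

Arguments vwt : simpl never.

(* The contraction ratio 6/7 of [sec_blocks_wt] dictates these weights. *)
Definition lwt (s : letter) : nat := if s is Some v then vwt v else 5.
Definition wwt (w : word) : nat := sumn (map lwt w).

Lemma wwt_cat u w : wwt (u ++ w) = (wwt u + wwt w)%N.
Proof. by rewrite /wwt map_cat sumn_cat. Qed.

Lemma wwt_cons s w : wwt (s :: w) = (lwt s + wwt w)%N. Proof. by []. Qed.

Lemma vwtD v1 v2 : (vwt (vadd v1 v2) <= vwt v1 + vwt v2)%N.
Proof. by case: v1 v2 => [[] []] [[] []]. Qed.

Lemma wwt_size w : (wwt w <= 6 * size w)%N.
Proof.
elim: w => // s w IHw; rewrite /wwt /= -/(wwt w) mulnS leq_add//.
by case: s => [[[] []]|].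
Qed.

Definition blocks (vs : seq klein4) : word :=
  flatten [seq [:: None; Some v] | v <- vs].

(** Only adjacent [klein4] letters are merged: a pair [aa] survives, separated by [v0]. Since [v0]
    has weight 0, the weight still does not grow. *)
Fixpoint nform (w : word) : klein4 * seq klein4 :=
  match w with
  | [::] => (v0, [::])
  | None :: w' => let: (v, vs) := nform w' in (v0, v :: vs)
  | Some u :: w' => let: (v, vs) := nform w' in (vadd v u, vs)
  end.

Definition nword (n : klein4 * seq klein4) : word := Some n.1 :: blocks n.2.

Lemma nform_eqlev w : eqlev 0 w (nword (nform w)).
Proof.
move=> X i _; elim: w => [|[u|] w IHw] x /=; first by rewrite /wact /= kact0.
- have := IHw (kact u x); case: (nform w) => v vs /= h.
  by rewrite [LHS]h /wact /= kactD.
- have := IHw (kflip x); case: (nform w) => v vs /= h.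
  by rewrite [LHS]h /wact /= kact0.
Qed.

Lemma wwt_nform w : (wwt (nword (nform w)) <= wwt w)%N.
Proof.
elim: w => [//|[u|] w IHw] /=; case: (nform w) IHw => v vs; rewrite /nword /=.
- rewrite !wwt_cons /= => h; have := vwtD v u.
  by rewrite -(leq_add2r (wwt (blocks vs))) => /leq_trans; apply; lia.
- by rewrite -[blocks (v :: vs)]/[:: None, Some v & blocks vs] !wwt_cons /=.
Qed.

Lemma wwt_blocks_size vs : (5 * size vs <= wwt (blocks vs))%N.
Proof.
elim: vs => // v vs IHvs.
by rewrite -[blocks _]/[:: None, Some v & blocks vs] !wwt_cons /=; lia.
Qed.

(** A block [a v] leaves [tau v] in one section and [a] or nothing in the other, so the bound is
    checked block by block. It is sharp for [v = d], where weight 7 becomes 6. *)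
Lemma sec_blocks_wt vs e :
  (7 * (wwt (sec e (blocks vs)) + wwt (sec (~~ e) (blocks vs)))
   <= 6 * wwt (blocks vs))%N.
Proof.
elim: vs e => // v vs /(_ _) IHvs e.
have -> : blocks (v :: vs) = [:: None; Some v] ++ blocks vs by [].
rewrite !sec_cat !wwt_cat.
have -> : aodd [:: None; Some v] = true by [].
rewrite !addbT negbK; have := IHvs e.
by case: e; case: v => [[] []] /=; rewrite /wwt /= /vwt /=; lia.
Qed.

(** * Powers of words and torsion *)

Fixpoint wpow (w : word) (n : nat) : word :=
  if n is n'.+1 then w ++ wpow w n' else [::].

Lemma wpowD w m n : wpow w (m + n) = wpow w m ++ wpow w n.
Proof. by elim: m => //= m ->; rewrite catA. Qed.

Lemma wpowM w m n : wpow w (m * n) = wpow (wpow w m) n.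
Proof. by elim: n => [|n IHn]; rewrite ?muln0// mulnS wpowD IHn. Qed.

Lemma wact_wpow (X : kaction) w n (x : X) :
  wact (wpow w n) x = iter n (wact w) x.
Proof. by elim: n x => //= n IHn x; rewrite wact_cat IHn -iterSr. Qed.

Definition tors (w : word) : Prop :=
  exists m r, (0 < m)%N /\ eqlev r (wpow w m) [::].

Lemma wact_wpow_id (X : kaction) w m n : @wact X (wpow w m) =1 id ->
  @wact X (wpow w (m * n)) =1 id.
Proof. by move=> h x; rewrite wpowM wact_wpow; elim: n => //= n ->; rewrite h. Qed.

Lemma tors_eqlev u w : eqlev 0 u w -> tors w -> tors u.
Proof.
move=> uw [m [r [m0 wm]]]; exists m, r; split=> // X i ri x.
rewrite -wm// !wact_wpow; apply: eq_iter => y; exact: uw.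
Qed.

Lemma tors_wpow w n : (0 < n)%N -> tors (wpow w n) -> tors w.
Proof.
move=> n0 [m [r [m0 wm]]]; exists (n * m)%N, r; split; first by rewrite muln_gt0 n0.
by rewrite wpowM.
Qed.

Lemma tors_conj s w : tors (rcons w s) -> tors (s :: w).
Proof.
move=> [m [r [m0 wm]]]; exists m, r; split=> // X i ri x.
apply: (can_inj (lactK s)).
apply: etrans (wm X i ri (lact s x)); rewrite !wact_wpow.
by elim: m {m0 wm} => //= m <-; rewrite wact_rcons wact_cons.
Qed.

(** For an even word the sections of a power are the powers of the sections, so the product of the
    two exponents works, one level higher. *)
Lemma tors_double w : ~~ aodd w -> tors (sec false w) -> tors (sec true w) ->
  tors w.
Proof.
move=> /negbTE ew [m0 [r0 [m0_gt0 h0]]] [m1 [r1 [m1_gt0 h1]]].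
exists (m0 * m1)%N, (maxn r0 r1).+1; split; first by rewrite muln_gt0 m0_gt0.
have powE n : aodd (wpow w n) = false.
  by elim: n => //= n IHn; rewrite aodd_cat ew IHn.
have secE e n : sec e (wpow w n) = wpow (sec e w) n.
  by elim: n => //= n IHn; rewrite sec_cat ew addbF IHn.
apply: eqlev_double => [|e]; first by rewrite powE.
move=> X i; rewrite geq_max => /andP[ri0 ri1]; rewrite secE; case: e.
- by rewrite mulnC; apply: wact_wpow_id; exact: h1.
- by apply: wact_wpow_id; exact: h0.
Qed.

(** Grigorchuk's argument, by induction on the weight: after a conjugation, pass to the sections of
    [w] if it contains an even number of [a], and to those of its square otherwise. They are
    strictly lighter. *)
Lemma torsP w : tors w.
Proof.
have [n] := ubnP (wwt w); elim: n w => // n IHn w wn.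
apply: (tors_eqlev (nform_eqlev w)).
have := leq_ltn_trans (wwt_nform w) wn; case: (nform w) => v [|v1 vs] {w wn}.
  move=> _; exists 2, 0%N; split=> // X i _ x.
  by rewrite /wact /= kactD vaddvv kact0.
rewrite /nword => wn /=; apply: tors_conj.
(* The conjugation has moved the leading letter to the end, where the last block absorbs it without
   raising the weight. *)
have [us [us0 usw]] : exists us, us <> [::] /\
    (eqlev 0 (rcons (blocks (v1 :: vs)) (Some v)) (blocks us) /\
     (wwt (blocks us) < n.+1)%N).
  exists (rcons (belast v1 vs) (vadd v (last v1 vs))); split.
    by case: (belast _ _).
  have bE t (z : klein4) : blocks (rcons t z) = rcons (rcons (blocks t) None) (Some z).
    by rewrite /blocks -cats1 map_cat flatten_cat /= -!cats1 -catA.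
  rewrite (lastI v1 vs) !bE; split.
    by move=> X i _ x; rewrite !wact_rcons /= kactD.
  move: wn; rewrite /nword /= -/(blocks _) (lastI v1 vs) bE.
  rewrite wwt_cons -!cats1 !wwt_cat [lwt _]/= /wwt /= !addn0.
  by have := vwtD v (last v1 vs); lia.
move: usw => [/tors_eqlev + usn]; apply.
set w := blocks us in usn *.
have w0 : (0 < wwt w)%N by rewrite /w; case: us us0 {usn w}.
have cw := sec_blocks_wt us false; rewrite -/w /= in cw.
case: (boolP (aodd w)) => ow; last first.
  by apply: tors_double => //; apply: IHn; move: ow usn cw w0 => _; lia.
apply: (@tors_wpow _ 2) => //=; rewrite cats0.
have ow2 : ~~ aodd (w ++ w) by rewrite aodd_cat ow.
(* Each section of [w ++ w] is made of both sections of [w], whose joint weight is at most 6/7 of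
   that of [w]. *)
by apply: tors_double => //; apply: IHn; rewrite sec_cat ow /= wwt_cat; lia.
Qed.

(** * Growth *)

Definition covered (W : word -> Prop) (E : word -> word -> Prop) (R : seq word) :=
  forall w, W w -> exists2 u, u \in R & E w u.

(** One word is chosen for each key, so counting classes of words reduces to counting keys. *)
Lemma covered_keys (K : eqType) (ks : seq K) (key : word -> K -> Prop)
    (W : word -> Prop) (E : word -> word -> Prop) :
  (forall w, W w -> exists2 k, k \in ks & key w k) ->
  (forall w w' k, W w -> W w' -> key w k -> key w' k -> E w w') ->
  exists2 R, size R = size ks & covered W E R.
Proof.
move=> hks hE; exists [seq xget [::] [set w | W w /\ key w k] | k <- ks].
  by rewrite size_map.
move=> w Ww; have [k kks wk] := hks w Ww.
exists (xget [::] [set w | W w /\ key w k]); first exact: map_f.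
have [Wu uk] := xgetPex [::] (ex_intro [set w | W w /\ key w k] w (conj Ww wk)).
exact: hE uk.
Qed.

(* The number of classes of [eqlev r] met by words of weight n grows at most
   like exp (lambda n). *)
Definition growth_rate (R : realType) (lambda : R) : Prop :=
  exists r (A : R), forall n : nat, exists2 Rs : seq word,
    (size Rs)%:R <= A * expR (lambda * n%:R) &
    covered (fun w => (wwt w <= n)%N) (eqlev r) Rs.

Fixpoint short_seqs (n : nat) : seq (seq klein4) :=
  if n is n'.+1 then [::] :: [seq v :: vs | v <- enum {: klein4}, vs <- short_seqs n']
  else [:: [::]].

Lemma card_klein : #|{: klein4}| = 4.
Proof. by rewrite card_prod card_bool. Qed.

Lemma size_short_seqs n : (size (short_seqs n) <= 5 ^ n)%N.
Proof.
elim: n => //= n IHn; rewrite size_allpairs -cardE card_klein expnS.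
by have : (0 < 5 ^ n)%N := expn_gt0 5 n; lia.
Qed.

Lemma mem_short_seqs n vs : (size vs <= n)%N -> vs \in short_seqs n.
Proof.
elim: n vs => [|n IHn] [|v vs] //= nvs.
rewrite inE /=; apply/allpairsP; exists (v, vs); split=> //=; first by rewrite mem_enum.
exact: IHn.
Qed.

Section Growth.
Context (R : realType).
Implicit Types lambda : R.

(** A block weighs at least 5, so weight [n] allows at most [n] blocks, and [5 ^ n <= exp (4 n)]. *)
Lemma growth_rate4 : growth_rate (4 : R).
Proof.
exists 0%N, 4 => n.
exists [seq nword (v, vs) | v <- enum {: klein4}, vs <- short_seqs n].
  rewrite size_allpairs -cardE card_klein natrM ler_pM2l//.
  rewrite (le_trans (y := (5 ^ n)%:R)) ?ler_nat ?size_short_seqs//.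
  rewrite natrX mulrC expRM_natl lerXn2r ?nnegrE ?expR_ge0//.
  by rewrite (le_trans _ (expR_ge1Dx _))//; lra.
move=> w wn; exists (nword (nform w)); last exact: nform_eqlev.
have := wwt_nform w; case: (nform w) => v vs.
rewrite /nword wwt_cons /= => h; apply/allpairsP; exists (v, vs); split=> //=.
  by rewrite mem_enum.
apply: mem_short_seqs; have h5 := wwt_blocks_size vs.
apply: (leq_trans (leq_pmull _ (isT : (0 < 5)%N))); apply: (leq_trans h5).
by apply: leq_trans (leq_addl _ _) (leq_trans h wn).
Qed.

(** One level higher, a word is determined by its leading letter, its parity and its two sections,
    of total weight at most [6 n / 7]. This gives the rate [6/7 lambda]; a further [lambda / 14]
    pays for the ways to split that weight. *)
Lemma growth_rateM lambda : 0 < lambda -> growth_rate lambda ->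
  growth_rate (13 / 14 * lambda).
Proof.
move=> l0 [r [A hA]].
have [Rs RsA Rscov] : exists2 Rs : nat -> seq word,
    (forall n, (size (Rs n))%:R <= A * expR (lambda * n%:R)) &
    (forall n, covered (fun w => (wwt w <= n)%N) (eqlev r) (Rs n)).
  have /choice[Rs h] : forall n, exists Rs : seq word,
      (size Rs)%:R <= A * expR (lambda * n%:R) /\
      covered (fun w => (wwt w <= n)%N) (eqlev r) Rs.
    by move=> n; have [Rs ? ?] := hA n; exists Rs.
  by exists Rs => n; have [] := h n.
(* Here 8 counts the pairs of a leading letter and a parity, and [14 / lambda + 1] is what makes
   [exp (lambda n / 14)] absorb the [N + 1] splittings. *)
exists r.+1, (8 * A ^+ 2 * (14 / lambda + 1)) => n.
pose N := (6 * n %/ 7)%N.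
pose keys m := [seq (x, y) | x <- enum {: klein4 * bool},
                             y <- [seq (u, u') | u <- Rs m, u' <- Rs (N - m)%N]].
pose ks := flatten [seq keys m | m <- iota 0 N.+1].
pose key w (k : klein4 * bool * (word * word)) :=
  [/\ (nform w).1 = k.1.1, aodd (blocks (nform w).2) = k.1.2,
      eqlev r (sec false (blocks (nform w).2)) k.2.1 &
      eqlev r (sec true (blocks (nform w).2)) k.2.2].
have [||T Tks Tcov] :=
    @covered_keys _ ks key (fun w => (wwt w <= n)%N) (eqlev r.+1).
- move=> w wn; have := sec_blocks_wt (nform w).2 false; have := wwt_nform w.
  rewrite /key; case: (nform w) => v vs /=.
  rewrite /nword wwt_cons /= => h1 h2.
  set m := wwt (sec false (blocks vs)) in h2.
  have mN : (m <= N)%N by rewrite /N leq_divRL//; lia.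
  have m'N : (wwt (sec true (blocks vs)) <= N - m)%N.
    by rewrite leq_subRL// /N leq_divRL//; lia.
  have [u uR h3] := Rscov m (sec false (blocks vs)) (leqnn _).
  have [u' u'R h4] := Rscov _ (sec true (blocks vs)) m'N.
  exists (v, aodd (blocks vs), (u, u')) => //.
  apply/flattenP; exists (keys m); first by apply: map_f; rewrite mem_iota.
  apply/allpairsP; exists (v, aodd (blocks vs), (u, u')); split=> //=.
    by rewrite mem_enum.
  by apply/allpairsP; exists (u, u').
- move=> w w' k _ _ [wv wo w0 w1] [w'v w'o w'0 w'1].
  apply: eqlev_trans (eqlev_leq _ (nform_eqlev w)) _ => //.
  apply: eqlev_trans (eqlev_sym (eqlev_leq _ (nform_eqlev w'))) => //.
  rewrite /nword wv w'v.
  apply: (@eqlev_cat _ [:: Some _] [:: Some _]) => //.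
  apply: eqlev_double; first by rewrite wo w'o.
  by case; [apply: eqlev_trans w1 _|apply: eqlev_trans w0 _]; exact: eqlev_sym.
exists T => //; rewrite Tks /ks size_flatten /shape -map_comp sumnE big_map natr_sum.
have A0 : 0 <= A.
  have := RsA 0; rewrite mulr0 expR0 mulr1; exact: le_trans.
have hN : N%:R <= 6 / 7 * n%:R :> R.
  rewrite mulrAC ler_pdivlMr// -!natrM ler_nat mulnC /N.
  by rewrite -[X in (_ <= X)%N]/(6 * n)%N mulnC leq_divM.
apply: (@le_trans _ _ (\sum_(0 <= m < N.+1) 8 * A ^+ 2 * expR (6 / 7 * lambda * n%:R))).
  rewrite -[iota 0 N.+1]/(index_iota 0 N.+1); apply: ler_sum_nat => m /andP[_ mN] /=.
  rewrite size_allpairs size_allpairs -cardE card_prod card_klein card_bool.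
  rewrite natrM -mulrA ler_pM2l// natrM.
  apply: le_trans (ler_pM _ _ (RsA m) (RsA (N - m)%N)) _ => //.
  rewrite mulrACA -expRD -expr2 ler_wpM2l ?sqr_ge0// ler_expR.
  rewrite -mulrDr -natrD subnKC//; have := ler_wpM2l (ltW l0) hN; lra.
rewrite sumr_const_nat subn0.
have -> : 13 / 14 * lambda * n%:R =
    6 / 7 * lambda * n%:R + lambda / 14 * n%:R by lra.
rewrite expRD -[leLHS]mulr_natr.
rewrite [leRHS](_ : _ = 8 * A ^+ 2 * expR (6 / 7 * lambda * n%:R) *
  ((14 / lambda + 1) * expR (lambda / 14 * n%:R))); last by ring.
rewrite ler_wpM2l ?mulr_ge0 ?sqr_ge0 ?expR_ge0//.
apply: (@le_trans _ _ ((14 / lambda + 1) * (1 + lambda / 14 * n%:R))); last first.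
  by rewrite ler_wpM2l ?expR_ge1Dx// addr_ge0// divr_ge0// ltW.
have -> : (14 / lambda + 1) * (1 + lambda / 14 * n%:R) =
    14 / lambda + 1 + n%:R + lambda / 14 * n%:R by field; rewrite gt_eqF.
have : 0 <= 14 / lambda by rewrite divr_ge0// ltW.
have : 0 <= lambda / 14 * n%:R by rewrite mulr_ge0// divr_ge0// ltW.
rewrite -natr1; have : 0 <= n%:R :> R by []; lra.
Qed.

(** Iterating the previous lemma from rate 4 gives subexponential growth, at the price of a higher
    level [r]. *)
Lemma growth_rate_gt0 lambda : 0 < lambda -> growth_rate lambda.
Proof.
move=> l0.
have gr t : growth_rate ((13 / 14) ^+ t * 4 : R).
  elim: t => [|t IHt]; first by rewrite mul1r; exact: growth_rate4.
  by rewrite exprS -mulrA; apply: growth_rateM => //; rewrite mulr_gt0// exprn_gt0//; lra.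
have [t tl] : exists t, (13 / 14) ^+ t * 4 <= lambda.
  have := @cvg_geometric R 4 (13 / 14).
  have -> : `|13 / 14| < 1 :> R by rewrite ger0_norm; lra.
  move=> /(_ isT) /cvgrPdist_lt /(_ _ l0) [t _ /(_ t (leqnn _))] /=.
  rewrite sub0r normrN ger0_norm; last by rewrite mulr_ge0// exprn_ge0//; lra.
  by rewrite /geometric /= mulrC => /ltW; exists t.
have [r [A hA]] := gr t; exists r, A => n; have [Rs RsA Rscov] := hA n.
exists Rs => //; apply: le_trans RsA _.
have A0 : 0 <= A.
  by have [Rs0 + _] := hA 0; rewrite mulr0 expR0 mulr1; exact: le_trans.
by rewrite ler_wpM2l// ler_expR ler_wpM2r.
Qed.
End Growth.

(** * Isoperimetry *)

Section Isoperimetry.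
Context (R : realType).
Implicit Types (X : kaction) (c : R).

Definition wvar X (phi : X -> R) (w : word) : R :=
  \sum_x `|phi x - phi (wact w x)|.

Definition lvar X (phi : X -> R) (s : letter) : R :=
  \sum_x `|phi x - phi (lact s x)|.

Lemma lvar_ge0 X (phi : X -> R) s : 0 <= lvar phi s.
Proof. exact: sumr_ge0. Qed.

(** Triangle inequality along the word; each letter acts bijectively, so the remaining sum can be
    reindexed. *)
Lemma wvar_le X (phi : X -> R) w : wvar phi w <= \sum_(s <- w) lvar phi s.
Proof.
elim: w => [|s w IHw].
  by rewrite big_nil /wvar big1// => x _; rewrite subrr normr0.
rewrite big_cons; apply: le_trans (lerD (lexx _) IHw).
rewrite [X in _ <= _ + X](reindex_inj (inv_inj (lactK s)))/= -big_split /=.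
apply: ler_sum => x _; rewrite wact_cons.
rewrite -[phi x - _](subrKA (phi (lact s x))); exact: ler_normD.
Qed.

Lemma wvar_le_size X (phi : X -> R) w :
  wvar phi w <= (size w)%:R * \sum_s lvar phi s.
Proof.
apply: le_trans (wvar_le _ _) _; elim: w => [|s w IHw].
  by rewrite big_nil mul0r.
rewrite big_cons /= -natr1 mulrDl addrC mul1r lerD//.
by rewrite (bigD1 s)//= lerDl sumr_ge0// => t _; exact: lvar_ge0.
Qed.

(** On a finite set constants have no variation, hence the restriction to functions supported in
    [P]. *)
Definition isoperimetric X (P : pred X) c : Prop :=
  forall phi : X -> R, (forall x, 0 <= phi x) -> (forall x, ~~ P x -> phi x = 0) ->
    c * \sum_x phi x <= \sum_s lvar phi s.

Definition tauV (v : klein4) : klein4 := (v.2, v.1 (+) v.2).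

Lemma tauVK v : tau (tauV v) = v.
Proof. by case: v => [[] []]. Qed.

(** Words that preserve the half [e] and act on it as [s]. Conjugation by [a] exchanges the two
    halves. *)
Definition dlift (e : bool) (s : letter) : word :=
  match s, e with
  | None, true => [:: None; Some (true, false); None]
  | None, false => [:: Some (true, false)]
  | Some v, true => [:: Some (tauV v)]
  | Some v, false => [:: None; Some (tauV v); None]
  end.

Lemma wact_dlift X e s (x : X) :
  @wact (kdouble X) (dlift e s) (e, x) = (e, lact s x).
Proof.
rewrite wact_double; case: s => [v|]; case: e => //=; rewrite /aodd /=.
all: by rewrite tauVK.
Qed.

(** On each half the five letters lift to words of length at most 3, which costs [15 * T]; the two
    halves give 30. *)
Lemma isoperimetric_double X (P : pred X) c : isoperimetric P c ->
  @isoperimetric (kdouble X) (fun y => P y.2) (c / 30).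
Proof.
move=> PX phi phi0 phiP; set T := \sum_s lvar phi s.
have T0 : 0 <= T by apply: sumr_ge0 => s _; exact: lvar_ge0.
have half e : c * \sum_x phi (e, x) <= 15 * T.
  apply: le_trans (PX (fun x => phi (e, x)) _ _) _ => //.
    by move=> x Px; exact: phiP.
  have -> : 15 * T = \sum_(s : letter) 3 * T.
    rewrite sumr_const card_option card_klein -mulrnAl; congr (_ * _).
    by rewrite -mulr_natr; lra.
  apply: ler_sum => s _; apply: (@le_trans _ _ (wvar phi (dlift e s))).
    have -> : lvar (fun x => phi (e, x)) s =
        \sum_x `|phi (e, x) - phi (@wact (kdouble X) (dlift e s) (e, x))|.
      by apply: eq_bigr => x _; rewrite wact_dlift.
    pose f (e' : bool) (x : X) :=
      `|phi (e', x) - phi (@wact (kdouble X) (dlift e s) (e', x))|.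
    rewrite [leRHS](_ : _ = \sum_e' \sum_x f e' x).
      rewrite (bigD1 e)//= lerDl; apply: sumr_ge0 => e' _.
      by apply: sumr_ge0 => x _; exact: normr_ge0.
    by rewrite pair_big; apply: eq_bigr => -[].
  apply: le_trans (wvar_le_size _ _) _; rewrite ler_wpM2r// ler_nat.
  by case: s; case: e.
have -> : \sum_x phi x = \sum_x phi (true, x) + \sum_x phi (false, x).
  transitivity (\sum_e \sum_x phi (e, x)); last by rewrite big_bool.
  by rewrite pair_big; apply: eq_bigr => -[].
have := half true; have := half false; lra.
Qed.

End Isoperimetry.

(** * Ping-pong on finite trees *)

Section Tree.
Context (m : nat).
Local Notation tree_car := (klein4 * {bseq m of klein4})%type.

(** The list is a stack: a nontrivial first coordinate is pushed, a trivial one is replaced by the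
    popped top. A push on a full stack, and a pop of nothing or of [v0], fix the point. The default
    of [insubd] is never reached. *)
Definition tflip (y : tree_car) : tree_car :=
  if y.1 != v0 then
    if (size y.2 < m)%N then (v0, insubd y.2 (y.1 :: y.2)) else y
  else if bseqval y.2 is v :: l then if v != v0 then (v, insubd y.2 l) else y else y.

Definition tact v (y : tree_car) : tree_car := (vadd v y.1, y.2).

Fact tflipK : involutive tflip.
Proof.
case=> v l; rewrite /tflip /=; have [->|nv] := eqVneq v v0.
  case: l => -[|u l] ul //=; have [->|nu] := eqVneq u v0; rewrite ?eqxx//=.
  rewrite nu /= val_insubd /=.
  have lm : (size l <= m)%N by exact: leq_trans ul.
  rewrite lm ul; congr (_, _); apply/val_inj.
  by rewrite val_insubd /= ul.
case: ltnP => /= lm; last by rewrite nv ltnNge lm.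
rewrite /= val_insubd /= lm nv; congr (_, _); apply/val_inj.
by rewrite val_insubd /= size_bseq.
Qed.

Fact tact0 y : tact v0 y = y.
Proof. by case: y => [[[] []] l]. Qed.
Fact tactD v1 v2 y : tact v1 (tact v2 y) = tact (vadd v1 v2) y.
Proof. by rewrite /tact /= vaddA. Qed.

(* A ball in the Schreier graph of (Z/2) * klein4 modulo Z/2: [(x, [:: x1; ..; xn])]
   stands for the coset of x a x1 a .. a xn, and a fixes the boundary. *)
Definition tree : kaction := KAction tflipK tact0 tactD.

Definition shallow (n : nat) (y : tree) : bool := (size y.2 < n)%N.

Lemma shallow_lact n s (y : tree) : shallow n y -> shallow n.+1 (lact s y).
Proof.
rewrite /shallow; case: s => [v|] /=; first exact: leqW.
case: y => v l; rewrite /= /tflip /=; case: ifP => _.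
  case: ifP => _ /=; last exact: leqW.
  by rewrite val_insubd; case: ifP => //= _; exact: leqW.
case: l => -[|u l] ul /=; first exact: leqW.
case: ifP => _ h /=; last exact: leqW.
by rewrite val_insubd; case: ifP => //= _; lia.
Qed.

(** The first [v] makes the first coordinate nontrivial, [a] pushes it and leaves [v0], and the last
    [v] turns [v0] into [v]. *)
Lemma ping_pong v (y : tree) : v != v0 -> y.1 != v -> shallow m y ->
  (wact [:: Some v; None; Some v] y).1 = v.
Proof.
move=> nv yv ym; rewrite !wact_cons /= /tflip /=.
have -> : vadd v y.1 != v0.
  by move: nv yv; case: (y.1) v => [[] []] [[] []].
by move: ym; rewrite /shallow => -> /=; case: v {nv yv} => [[] []].
Qed.

(** For each nontrivial [v], the word [v a v] carries the mass outside the class of [v] into it, up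
    to an error [3 * T]. The three classes are disjoint, so summing gives [3 S <= 2 S + 9 T]. *)
Lemma isoperimetric_tree (R : realType) : @isoperimetric R tree (shallow m) (1 / 9).
Proof.
move=> phi phi0 phiP; set T := \sum_s lvar phi s.
pose g v : word := [:: Some v; None; Some v].
pose p v := \sum_(y : tree | y.1 == v) phi y.
set S := \sum_x phi x.
have hv v : v != v0 -> S <= 2 * p v + 3 * T.
  move=> nv.
  have : \sum_(y : tree | y.1 != v) phi y <= wvar phi (g v) + p v.
    rewrite big_mkcond /= [p v]big_mkcond /=.
    rewrite [X in _ <= _ + X](reindex_inj (@wact_inj tree (g v)))/= -big_split /=.
    apply: ler_sum => y _; case: ifPn => yv; last by rewrite addr_ge0//; case: ifP.
    have [ym|/phiP ->] := boolP (shallow m y).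
      rewrite ifT; last exact/eqP/ping_pong.
      by rewrite -lerBlDr ler_norm.
    by rewrite addr_ge0//; case: ifP.
  have := wvar_le_size phi (g v); rewrite -/T.
  have -> : S = p v + \sum_(y : tree | y.1 != v) phi y.
    by rewrite /S (bigID (fun y : tree => y.1 == v)).
  move=> /=; lra.
have : \sum_v p v = S.
  by rewrite /S (partition_big (fun y : tree => y.1) xpredT).
have p0 v : 0 <= p v by apply: sumr_ge0.
have e3 : \sum_v p v = p v0 + p (true, false) + p (true, true) + p (false, true).
  rewrite -(pair_big xpredT xpredT (fun a b => p (a, b))) /= !big_bool /=.
  by rewrite /v0; lra.
have := hv (true, false) isT; have := hv (true, true) isT.
have := hv (false, true) isT; have := p0 v0; rewrite e3; lra.
Qed.

Definition root : tree := (v0, [bseq]).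

End Tree.

(** * Towers over a tree *)

Fixpoint base (X : kaction) (i : nat) : tower i X -> X :=
  if i is i'.+1 then fun y => base y.2 else id.

Fixpoint tower_pt (X : kaction) (i : nat) (x : X) : tower i X :=
  if i is i'.+1 then (true, tower_pt i' x) else x.

Lemma base_pt (X : kaction) i (x : X) : base (tower_pt i x) = x.
Proof. by elim: i => //= i ->. Qed.

(** Hence a letter changes the depth of the base point by at most one. The letter [Some v0] stands
    for no move. *)
Lemma base_lact (X : kaction) i s (y : tower i X) : exists t, base (lact s y) = lact t (base y).
Proof.
elim: i s y => [|i IHi] s y /=; first by exists s.
case: y => e y /=; case: s => [v|] /=; last by exists (Some v0); rewrite /= kact0.
case: e; first exact: (IHi (Some (tau v))).
case: ifP => _; first exact: (IHi None).
by exists (Some v0); rewrite /= kact0.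
Qed.

Lemma shallow_wact m i w n (y : tower i (tree m)) : shallow n (base y) ->
  shallow (n + size w) (base (wact w y)).
Proof.
elim: w n y => [|s w IHw] n y yn /=; first by rewrite addn0.
rewrite wact_cons addnS -addSn; apply: IHw.
by have [t ->] := base_lact s y; exact: shallow_lact.
Qed.

Lemma isoperimetric_tower (R : realType) m i :
  @isoperimetric R (tower i (tree m)) (fun y => shallow m (base y)) (1 / 9 / 30 ^+ i).
Proof.
elim: i => [|i IHi]; first by rewrite expr0 divr1; exact: isoperimetric_tree.
have -> : 1 / 9 / 30 ^+ i.+1 = 1 / 9 / 30 ^+ i / 30 :> R.
  by rewrite exprS invfM mulrA mulrAC.
exact: isoperimetric_double IHi.
Qed.

(** * Finite sums over a group *)

Section GroupSum.
Context (R : realType) (G : groupType).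
Implicit Types f h : G -> R.

Definition finsupp f : Prop := finite_set [set x | f x != 0].

Definition gsum f : R := \sum_(x \in [set: G]) f x.

Lemma gsumE f (s : seq G) : uniq s -> (forall x, f x != 0 -> x \in s) ->
  gsum f = \sum_(x <- s) f x.
Proof.
move=> us fs; rewrite /gsum (@fsbigE _ _ _ _ _ s)//; last first.
  by move=> x _ xs; apply: contraNeq xs => /fs.
by apply: eq_bigl => x; rewrite in_setT.
Qed.

Lemma finsupp_list f : finsupp f ->
  exists2 s, uniq s & forall x, (x \in s) = (f x != 0).
Proof.
move=> ff; exists (fset_set [set x | f x != 0]); first exact: fset_uniq.
by move=> x; rewrite in_fset_set ?mem_setE.
Qed.

Lemma finsuppP f : finsupp f <-> exists s : seq G, forall x, f x != 0 -> x \in s.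
Proof.
split=> [/finsupp_list[s _ sf]|[s sf]]; first by exists s => x; rewrite sf.
exact: sub_finite_set sf (finite_seq s).
Qed.

Lemma finsupp_sub f h : (forall x, h x = 0 -> f x = 0) -> finsupp h -> finsupp f.
Proof.
move=> hf; apply: sub_finite_set => x /=; apply: contra_neq; exact: hf.
Qed.

Lemma finsupp2 f h : finsupp f -> finsupp h ->
  exists s : seq G, [/\ uniq s, forall x, f x != 0 -> x \in s &
    forall x, h x != 0 -> x \in s].
Proof.
move=> /finsuppP[s sf] /finsuppP[t th]; exists (undup (s ++ t)).
split=> [|x xf|x xf]; rewrite ?undup_uniq// mem_undup mem_cat.
  by rewrite sf.
by rewrite th// orbT.
Qed.

Lemma finsuppD f h : finsupp f -> finsupp h -> finsupp (fun x => f x + h x).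
Proof.
move=> ff fh; have [s [_ sf sh]] := finsupp2 ff fh.
apply/finsuppP; exists s => x; apply: contraR => xs; apply/eqP.
by rewrite (eqP (contraR (sf x) xs)) (eqP (contraR (sh x) xs)) addr0.
Qed.

Lemma finsuppB f h : finsupp f -> finsupp h -> finsupp (fun x => f x - h x).
Proof.
by move=> ff fh; apply: finsuppD => //; apply: finsupp_sub fh => x ->; rewrite oppr0.
Qed.

Lemma finsupp_sum (I : Type) (r : seq I) (f : I -> G -> R) :
  (forall i, finsupp (f i)) -> finsupp (fun x => \sum_(i <- r) f i x).
Proof.
move=> ff; elim: r => [|i r IHr].
  by apply/finsuppP; exists [::] => x; rewrite big_nil eqxx.
by under eq_fun do rewrite big_cons; exact: finsuppD.
Qed.

Lemma finsupp_translate g f : finsupp f -> finsupp (fun x => f (g * x)%g).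
Proof.
move=> /finsuppP[s sf]; apply/finsuppP; exists [seq (g^-1 * x)%g | x <- s] => x.
by move=> /sf gs; rewrite -[x](mulKg g); exact: map_f.
Qed.

Lemma gsum0 : gsum (fun=> 0) = 0.
Proof. by rewrite /gsum fsbig1. Qed.

Lemma eq_gsum f h : f =1 h -> gsum f = gsum h.
Proof. by move=> /funext ->. Qed.

Lemma gsumD f h : finsupp f -> finsupp h ->
  gsum (fun x => f x + h x) = gsum f + gsum h.
Proof.
move=> ff fh; have [s [us sf sh]] := finsupp2 ff fh.
rewrite !(gsumE us)// ?big_split// => x; apply: contraR => xs; apply/eqP.
by rewrite (eqP (contraR (sf x) xs)) (eqP (contraR (sh x) xs)) addr0.
Qed.

Lemma gsumZ c f : finsupp f -> gsum (fun x => c * f x) = c * gsum f.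
Proof.
move=> /finsupp_list[s us sf]; rewrite !(gsumE us)// ?mulr_sumr// => x.
- by rewrite sf.
- by rewrite sf; apply: contra_neq => ->; rewrite mulr0.
Qed.

Lemma gsumN f : finsupp f -> gsum (fun x => - f x) = - gsum f.
Proof.
by move=> ff; rewrite -mulN1r -gsumZ//; apply: eq_gsum => x; rewrite mulN1r.
Qed.

Lemma gsumB f h : finsupp f -> finsupp h ->
  gsum (fun x => f x - h x) = gsum f - gsum h.
Proof.
move=> ff fh; rewrite gsumD ?gsumN//.
by apply: finsupp_sub fh => x ->; rewrite oppr0.
Qed.

Lemma gsum_sum (I : Type) (r : seq I) (f : I -> G -> R) :
  (forall i, finsupp (f i)) ->
  gsum (fun x => \sum_(i <- r) f i x) = \sum_(i <- r) gsum (f i).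
Proof.
move=> ff; elim: r => [|i r IHr].
  by under eq_gsum do rewrite big_nil; rewrite gsum0 big_nil.
under eq_gsum do rewrite big_cons; rewrite gsumD ?IHr ?big_cons//.
exact: finsupp_sum.
Qed.

Lemma ler_gsum f h : finsupp f -> finsupp h -> (forall x, f x <= h x) ->
  gsum f <= gsum h.
Proof.
move=> ff fh fh_le; have [s [us sf sh]] := finsupp2 ff fh.
by rewrite !(gsumE us)//; apply: ler_sum.
Qed.

Lemma gsum_ge0 f : (forall x, 0 <= f x) -> 0 <= gsum f.
Proof. by move=> f0; rewrite /gsum; apply: fsumr_ge0. Qed.

Lemma ler_norm_gsum f : finsupp f -> `|gsum f| <= gsum (fun x => `|f x|).
Proof.
move=> /finsupp_list[s us sf].
rewrite !(gsumE us); first exact: ler_norm_sum.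
- by move=> x; rewrite sf normr_eq0.
- by move=> x; rewrite sf.
Qed.

Lemma gsum_translate g f : gsum (fun x => f (g * x)%g) = gsum f.
Proof.
rewrite /gsum [RHS](reindex_fsbigT (fun x => (g * x)%g))//.
exists (fun x => (g^-1 * x)%g) => x; [exact: mulKg|exact: mulKVg].
Qed.

Lemma gsum_gt0 f x : finsupp f -> (forall y, 0 <= f y) -> 0 < f x -> 0 < gsum f.
Proof.
move=> /finsupp_list[s us sf] f0 fx; rewrite (gsumE us); last by move=> y; rewrite sf.
rewrite (bigD1_seq x)//=; last by rewrite sf gt_eqF.
by rewrite ltr_wpDr// sumr_ge0.
Qed.
End GroupSum.

(** * Diagonal products *)

Section Diag.
Context (Xs : nat -> kaction).

Definition wperm (X : kaction) (w : word) : {perm X} := perm (@wact_inj X w).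

Lemma wpermE (X : kaction) w (x : X) : wperm X w x = wact w x.
Proof. by rewrite permE. Qed.

Lemma wperm_cat X u w : wperm X (u ++ w) = (wperm X u * wperm X w)%g.
Proof. by apply/permP => x; rewrite permM !wpermE wact_cat. Qed.

Lemma wperm_rev X w : wperm X (rev w) = (wperm X w)^-1%g.
Proof.
apply/permP => x; apply: (@perm_inj _ (wperm X w)).
by rewrite permKV !wpermE -[X in wact X _ = _]revK wact_revK.
Qed.

(** The image of the free product in the product of the permutation groups of all stages. The word
    is only asserted to exist, so equality is equality at every stage. *)
Record diag := Diag {
  dval : forall k, {perm Xs k};
  dvalP : exists w, forall k, dval k = wperm (Xs k) w }.

Lemma diagP (g h : diag) : (forall k, dval g k = dval h k) -> g = h.
Proof.
case: g h => [g gP] [h hP] /= gh.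
have e : g = h by apply: functional_extensionality_dep.
by move: hP; rewrite -e => hP; congr Diag; exact: Prop_irrelevance.
Qed.

HB.instance Definition _ := gen_eqMixin diag.
HB.instance Definition _ := gen_choiceMixin diag.

Definition ev (w : word) : diag :=
  @Diag (fun k => wperm (Xs k) w) (ex_intro _ w (fun=> erefl)).

Lemma evP (g : diag) : exists w, g = ev w.
Proof. by have [w gw] := dvalP g; exists w; apply: diagP. Qed.

Fact diag_mulP (g h : diag) :
  exists w, forall k, (dval g k * dval h k)%g = wperm (Xs k) w.
Proof.
have [u gu] := dvalP g; have [w hw] := dvalP h.
by exists (u ++ w) => k; rewrite gu hw wperm_cat.
Qed.

Fact diag_invP (g : diag) : exists w, forall k, (dval g k)^-1%g = wperm (Xs k) w.
Proof. by have [u gu] := dvalP g; exists (rev u) => k; rewrite gu wperm_rev. Qed.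

Let one := ev [::].
Let mul g h := Diag (diag_mulP g h).
Let inv g := Diag (diag_invP g).

Let oneE k : dval one k = 1%g.
Proof. by apply/permP => x; rewrite wpermE perm1. Qed.
Let mulA : associative mul.
Proof. by move=> f g h; apply: diagP => k /=; rewrite mulgA. Qed.
Let mul1 : left_id one mul.
Proof.
move=> f; apply: diagP => k; rewrite [LHS]/(dval one k * dval f k)%g oneE.
exact: mul1g.
Qed.
Let mulr1 : right_id one mul.
Proof.
move=> f; apply: diagP => k; rewrite [LHS]/(dval f k * dval one k)%g oneE.
exact: mulg1.
Qed.
Let mulV : left_inverse one inv mul.
Proof. by move=> f; apply: diagP => k; rewrite oneE; exact: mulVg. Qed.
Let mulrV : right_inverse one inv mul.
Proof. by move=> f; apply: diagP => k; rewrite oneE; exact: mulgV. Qed.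

HB.instance Definition _ := isGroup.Build diag mulA mul1 mulr1 mulV mulrV.

Lemma ev_nil : ev [::] = 1%g. Proof. by []. Qed.

Lemma ev_cat u w : ev (u ++ w) = (ev u * ev w)%g.
Proof. by apply: diagP => k /=; rewrite wperm_cat. Qed.

Lemma ev_rev w : ev (rev w) = (ev w)^-1%g.
Proof. by apply: diagP => k /=; rewrite wperm_rev. Qed.

Lemma ev_wpow w n : ev (wpow w n) = (ev w ^+ n)%g.
Proof. by elim: n => [|n IHn] //=; rewrite expgS ev_cat IHn. Qed.

Definition gens : seq diag := [seq ev [:: s] | s <- enum {: letter}].

Lemma diag_generates : generates [in gens].
Proof.
move=> H [H1 HM] gH g; have [w ->] := evP g.
have HV x : x \in H -> x^-1%g \in H by move=> xH; rewrite -[x^-1%g]mul1g; exact: HM.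
elim: w => [|s w IHw] //.
rewrite -cat1s ev_cat -[ev w]invgK; apply: HM; last exact: HV.
by apply: gH; apply: map_f; rewrite mem_enum.
Qed.

Definition wball (n : nat) : set diag := [set g | exists2 w, (size w <= n)%N & g = ev w].

Lemma wball1 n : wball n 1%g.
Proof. by exists [::]. Qed.

Lemma wballM m n g h : wball m g -> wball n h -> wball (m + n) (g * h)%g.
Proof.
move=> [u um ->] [w wn ->]; exists (u ++ w); last by rewrite ev_cat.
by rewrite size_cat leq_add.
Qed.

Lemma wball_leq m n : (m <= n)%N -> wball m `<=` wball n.
Proof. by move=> mn g [w wm ->]; exists w => //; exact: leq_trans mn. Qed.

Lemma wballT g : exists n, wball n g.
Proof. by have [w ->] := evP g; exists (size w), w. Qed.


Section Isoperimetry.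
Context (R : realType).
Implicit Types (F : diag -> R).

(* Push F forward to [Xs k] along g |-> z g^-1. *)
Lemma diag_isoperimetric k (z : Xs k) (P : pred (Xs k)) (c : R) F :
  isoperimetric P c -> (forall g, 0 <= F g) -> finsupp F ->
  (forall g, F g != 0 -> P (dval g^-1%g k z)) ->
  c * gsum F <= \sum_(s <- gens) gsum (fun x => `|F x - F (s^-1 * x)%g|).
Proof.
move=> Pc F0 fF FP; pose y (g : diag) : Xs k := dval g^-1%g k z.
pose phi (x : Xs k) : R := gsum (fun g => (y g == x)%:R * F g).
have fyF x : finsupp (fun g => (y g == x)%:R * F g).
  by apply: finsupp_sub fF => g ->; rewrite mulr0.
have sum_y h : finsupp h -> \sum_x gsum (fun g => (y g == x)%:R * h g) = gsum h.
  move=> fh; rewrite -gsum_sum; last first.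
    by move=> x; apply: finsupp_sub fh => g ->; rewrite mulr0.
  apply: eq_gsum => g; rewrite -mulr_suml (bigD1 (y g))//= eqxx big1 ?addr0 ?mul1r//.
  by move=> x /negbTE; rewrite eq_sym => ->.
rewrite -sum_y//; apply: le_trans (Pc phi _ _) _.
- by move=> x; apply: gsum_ge0 => g; rewrite mulr_ge0.
- move=> x Px; rewrite /phi -[RHS](gsum0 R diag); apply: eq_gsum => g.
  have [yx|_] := eqVneq (y g) x; last by rewrite mul0r.
  have [->|/FP] := eqVneq (F g) 0; first by rewrite mulr0.
  by rewrite -/(y g) yx (negbTE Px).
rewrite /gens big_map big_enum /=; apply: ler_sum => s _.
set g0 := ev [:: s].
have g0V : g0^-1%g = g0 by rewrite -ev_rev.
have fd : finsupp (fun x => F x - F (g0^-1 * x)%g).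
  by apply: finsuppB => //; exact: finsupp_translate.
rewrite -[leRHS]sum_y; last by apply: finsupp_sub fd => x ->; rewrite normr0.
apply: ler_sum => x _.
(* The inverse in [y] turns left translation by [g0] into the action of [s]: [y (g0^-1 g)] is
   [lact s (y g)]. *)
have -> : phi (lact s x) = gsum (fun g => (y g == x)%:R * F (g0^-1 * g)%g).
  rewrite /phi -(gsum_translate g0^-1%g); apply: eq_gsum => g; congr (_%:R * _).
  rewrite /y invgM invgK -[dval _ _ _]/((dval g^-1%g k * dval g0 k)%g z) permM /=.
  by rewrite wpermE (inj_eq (inv_inj (lactK s))).
have fyF' : finsupp (fun g => (y g == x)%:R * F (g0^-1 * g)%g).
  by apply: finsupp_sub (finsupp_translate g0^-1%g fF) => g ->; rewrite mulr0.
rewrite /phi -gsumB//; apply: le_trans (ler_norm_gsum _) _; first exact: finsuppB.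
rewrite le_eqVlt; apply/orP; left; apply/eqP/eq_gsum => g.
by rewrite -mulrBr normrM normr_nat.
Qed.

End Isoperimetry.

(** By [torsP] some power is trivial at all stages from [K] on; the finitely many earlier stages are
    finite, and the orders there are multiplied in. *)
Lemma diag_torsion :
  (forall r, exists K, forall k, (K <= k)%N -> forall u w, eqlev r u w ->
    @wact (Xs k) u =1 @wact (Xs k) w) ->
  torsion diag.
Proof.
move=> hX g; have [w ->] := evP g; have [m [r [m0 wm]]] := torsP w.
have [K hK] := hX r.
have hpow n k : wperm (Xs k) (wpow w n) = (wperm (Xs k) w ^+ n)%g.
  by elim: n => [|n IHn]; [apply/permP => x; rewrite wpermE perm1
                          |rewrite /= wperm_cat IHn expgS].
exists (m * \prod_(k < K) #[wperm (Xs k) w]%g)%N.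
  by rewrite muln_gt0 m0 prodn_gt0.
rewrite -ev_wpow -ev_nil; apply: diagP => k /=; rewrite hpow.
have -> : wperm (Xs k) [::] = 1%g by apply/permP => x; rewrite wpermE perm1.
have [kK|Kk] := ltnP k K.
  rewrite mulnC (bigD1 (Ordinal kK))//= -mulnA expgM expg_order expg1n.
  by [].
rewrite expgM -hpow (_ : wperm _ (wpow w m) = 1%g) ?expg1n//.
by apply/permP => x; rewrite wpermE perm1 (hK k Kk _ _ wm).
Qed.

(** An element is determined by its class at level [r], which fixes the stages from [K] on, and by
    its permutations at the earlier stages. *)
Lemma diag_cover (K r n : nat) (Rs : seq word) :
  (forall k, (K <= k)%N -> forall u w, eqlev r u w ->
    @wact (Xs k) u =1 @wact (Xs k) w) ->
  covered (fun w => (wwt w <= n)%N) (eqlev r) Rs ->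
  exists2 T : seq diag, (size T <= (\prod_(k < K) #|{perm Xs k}|) * size Rs)%N &
    forall w, (wwt w <= n)%N -> ev w \in T.
Proof.
move=> hK Rscov.
have [T Tsize Tcov] : exists2 T, (size T <= (\prod_(k < K) #|{perm Xs k}|) * size Rs)%N &
    covered (fun w => (wwt w <= n)%N)
      (fun u w => eqlev r u w /\ forall k, (k < K)%N -> wperm (Xs k) u = wperm (Xs k) w) T.
  elim: (K) => [|k [T Tsize Tcov]].
    by exists Rs; [rewrite big_ord0 mul1n|move=> w /Rscov[u uR wu]; exists u].
  pose key w (p : {perm Xs k} * word) := [/\ wperm (Xs k) w = p.1, eqlev r w p.2 &
    forall l, (l < k)%N -> wperm (Xs l) w = wperm (Xs l) p.2].
  have [||T' T'size T'cov] := @covered_keys _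
      [seq (p, u) | p <- enum {: {perm Xs k}}, u <- T] key (fun w => (wwt w <= n)%N)
      (fun u w => eqlev r u w /\ forall l, (l < k.+1)%N -> wperm (Xs l) u = wperm (Xs l) w).
  - move=> w /Tcov[u uT [wu wu']]; exists (wperm (Xs k) w, u) => //.
    by apply/allpairsP; exists (wperm (Xs k) w, u); split=> //=; rewrite mem_enum.
  - move=> w w' p _ _ [w1 w2 w3] [w'1 w'2 w'3]; split.
      by apply: eqlev_trans w2 _; exact: eqlev_sym.
    move=> l; rewrite ltnS leq_eqVlt => /predU1P[->|lk]; first by rewrite w1 w'1.
    by rewrite w3// w'3.
  exists T' => //; rewrite T'size size_allpairs -cardE big_ord_recr /= mulnAC.
  by rewrite mulnC leq_mul2r Tsize orbT.
exists (map ev T); first by rewrite size_map.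
move=> w /Tcov[u uT [wu wu']]; rewrite (_ : ev w = ev u); first exact: map_f.
apply: diagP => k; have [kK|Kk] := ltnP k K; first exact: wu'.
by apply/permP => x; rewrite /= !wpermE; exact: hK.
Qed.

End Diag.

(** * Choice of the heights and of the time scales *)

Section Oscillation.
Context (R : realType) (D : nat) (omega : nat -> R -> R).
Hypothesis omega_gt0 : forall k c, 0 < c -> 0 < omega k c.

(** The constant of [isoperimetric_tower]. It ignores the radius of the tree, so the time scale can
    be chosen before that radius. *)
Definition cst_of (i : nat) : R := 1 / 9 / 30 ^+ i.

Lemma cst_of_gt0 i : 0 < cst_of i.
Proof. by rewrite !divr_gt0// exprn_gt0. Qed.

Lemma pick_scale (k i C : nat) : exists Nr : nat * nat, (2 * k <= Nr.1)%N /\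
  exists2 Rs : seq word,
    (C * size Rs)%:R <= expR (omega k (cst_of i) * Nr.1%:R) &
    covered (fun w => (wwt w <= 6 * (k * Nr.1))%N) (eqlev Nr.2) Rs.
Proof.
have w0 := omega_gt0 k (cst_of_gt0 i); set w := omega k _ in w0 *.
(* At this rate, words of weight [6 k N] use at most half of the exponent [w N]; the other half
   absorbs [C A]. *)
have l0 : 0 < w / (12 * k.+1%:R) by rewrite divr_gt0// mulr_gt0.
have [r [A hA]] := growth_rate_gt0 l0.
have A0 : 0 <= A.
  by have [Rs0 + _] := hA 0; rewrite mulr0 expR0 mulr1; exact: le_trans.
pose n := Num.Def.archi_bound (2 * (C%:R * A) / w).
have nP : 2 * (C%:R * A) / w < n%:R.
  by rewrite archi_boundP// divr_ge0 ?mulr_ge0// ltW.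
pose N := (n + 2 * k)%N; exists (N, r); split; first by rewrite /= leq_addl.
have [Rs RsA Rscov] := hA (6 * (k * N))%N; exists Rs => //=.
rewrite natrM; apply: (@le_trans _ _ (C%:R * A * expR (w / 2 * N%:R))).
  rewrite -mulrA ler_wpM2l//; apply: le_trans RsA _; rewrite ler_wpM2l// ler_expR.
  rewrite natrM mulrA natrM mulrA ler_wpM2r//.
  have -> : w / (12 * k.+1%:R) * 6%:R * k%:R = w / 2 * (k%:R / k.+1%:R).
    by field; rewrite addrC natr1 pnatr_eq0.
  have w20 : 0 <= w / 2 by rewrite divr_ge0// ltW.
  by rewrite ler_piMr// ler_pdivrMr// mul1r ler_nat.
have -> : w * N%:R = w / 2 * N%:R + w / 2 * N%:R by lra.
rewrite expRD ler_wpM2r ?expR_ge0//; apply: le_trans (expR_ge1Dx _).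
move: nP; rewrite ltr_pdivrMr// /N natrD => nP.
have : 0 <= w / 2 * (2 * k)%:R by rewrite mulr_ge0// divr_ge0// ltW.
by lra.
Qed.

Let scale k i C : nat * nat := sval (cid (pick_scale k i C)).

Definition stage_tree (k i C : nat) : kaction :=
  tower i (tree (k * (scale k i C).1).+1).

(* Only the next height and the bound [C] on the order of the finite stages so far
   are carried over.  The height of stage k.+1 exceeds the level from which the
   growth estimate of stage k holds, hence so do all later ones. *)
Fixpoint stage (k : nat) : nat * nat :=
  if k is k'.+1 then
    let: (i, C) := stage k' in
    (maxn i.+1 (scale k' i C).2, (C * #|{perm stage_tree k' i C}|)%N)
  else (0, 1)%N.

Let height k := (stage k).1.
Let order k := (stage k).2.
Let NN k := (scale k (height k) (order k)).1.
Let rr k := (scale k (height k) (order k)).2.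

(** All factors share one sequence of heights and time scales; at each stage those with another
    index get the one-point action. *)
Definition stage_action (j k : nat) : kaction :=
  if (k %% D == j)%N then tower (height k) (tree (k * NN k).+1) else kunit.

Let heightS k : height k.+1 = maxn (height k).+1 (rr k).
Proof. by rewrite /rr /order /height /=; case: (stage k). Qed.

Let orderS k : order k.+1 = (order k * #|{perm tower (height k) (tree (k * NN k).+1)}|)%N.
Proof. by rewrite /NN /order /height /=; case: (stage k). Qed.

Let height_homo k l : (k <= l)%N -> (height k <= height l)%N.
Proof.
move=> /subnKC <-; elim: (l - k)%N => [|n IHn]; first by rewrite addn0.
by rewrite addnS heightS (leq_trans IHn)// (leq_trans _ (leq_maxl _ _)).
Qed.

Let height_ge k : (k <= height k)%N.
Proof.
by elim: k => // k IHk; rewrite heightS (leq_trans _ (leq_maxl _ _)).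
Qed.

Let eqlev_stage j r k u w : ((k %% D == j)%N -> (r <= height k)%N) -> eqlev r u w ->
  @wact (stage_action j k) u =1 @wact (stage_action j k) w.
Proof.
rewrite /stage_action; case: ifP => [_ /(_ isT) rk uw|_ _ _ x]; first exact: uw.
by case: (wact u x); case: (wact w x).
Qed.

(** [order] multiplies the contributions of all stages, so it serves every [j] at once. *)
Let card_stage j k : (\prod_(l < k) #|{perm stage_action j l}| <= order k)%N.
Proof.
elim: k => [|k IHk]; first by rewrite big_ord0.
rewrite big_ord_recr /= orderS leq_mul// /stage_action; case: ifP => // _.
apply: (@leq_trans 1); last by apply/card_gt0P; exists 1%g.
apply/card_le1_eqP => s t _ _; apply/permP => x.
by case: (s x); case: (t x).
Qed.

Lemma oscillating_groups :
  exists (Xs : nat -> nat -> kaction) (c : nat -> R) (N : nat -> nat),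
  [/\ forall k, 0 < c k, forall k, (2 * k <= N k)%N,
      forall j, torsion (diag (Xs j)),
      forall j k, (k %% D)%N = j -> forall F : diag (Xs j) -> R,
        (forall g, 0 <= F g) -> finsupp F ->
        (forall g, F g != 0 -> wball (k * N k) g) ->
        c k * gsum F <=
          \sum_(s <- gens (Xs j)) gsum (fun x => `|F x - F (s^-1 * x)%g|) &
      forall j k, (k %% D)%N <> j -> exists2 T : seq (diag (Xs j)),
        (size T)%:R <= expR (omega k (c k) * (N k)%:R) &
        forall g, wball (k * N k) g -> g \in T].
Proof.
exists stage_action, (fun k => cst_of (height k)), NN; split.
- by move=> k; exact: cst_of_gt0.
- by move=> k; have [] := svalP (cid (pick_scale k (height k) (order k))).
- move=> j; apply: diag_torsion => r; exists r => k rk u w; apply: eqlev_stage => _.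
  exact: leq_trans (height_ge k).
- move=> j k kj F F0 fF FN.
  have Xk : stage_action j k = tower (height k) (tree (k * NN k).+1).
    by rewrite /stage_action kj eqxx.
  have [z [P [cP zP]]] : exists (z : stage_action j k) (P : pred (stage_action j k)),
      isoperimetric P (cst_of (height k)) /\
      forall w, (size w <= k * NN k)%N -> P (wact w z).
    rewrite Xk; exists (tower_pt (height k) (root _)).
    exists (fun y => shallow (k * NN k).+1 (base y)).
    split; first exact: isoperimetric_tower.
    (* The root has depth 0, so it is shallow at 1, and a word of length [k N] leaves it shallow at
       [k N + 1], the radius of the tree. *)
    move=> w wk; have := @shallow_wact (k * NN k).+1 (height k) w 1.
    move=> /(_ (tower_pt _ (root _))); rewrite base_pt => /(_ isT).
    by rewrite /shallow => /leq_trans; apply; rewrite add1n ltnS.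
  apply: (@diag_isoperimetric _ _ k z P) => // g /FN[w wk ->].
  by rewrite -ev_rev /= wpermE; apply: zP; rewrite size_rev.
- move=> j k kj.
  have [_ [Rs Rssize Rscov]] := svalP (cid (pick_scale k (height k) (order k))).
  have [|T Tsize TP] := @diag_cover (stage_action j) k (rr k) _ Rs _ Rscov.
  + move=> l kl u w; apply: eqlev_stage => /eqP lj.
    (* Stage [k] itself is trivial for this [j], and the later heights are at least [rr k] by
       construction. *)
    have {}kl : (k < l)%N.
      by rewrite ltn_neqAle kl andbT; apply/eqP => kl'; apply: kj; rewrite kl'.
    by rewrite (leq_trans _ (height_homo kl))// heightS leq_maxr.
  exists T.
    apply: le_trans Rssize; rewrite ler_nat; apply: leq_trans Tsize _.
    by rewrite leq_mul2r card_stage orbT.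
  move=> g [w wk ->]; apply: TP; apply: leq_trans (wwt_size w) _.
  by rewrite leq_mul2l.
Qed.

End Oscillation.

(** * Energy of random walks *)

Section Convolution.
Context (R : realType) (G : groupType).
Implicit Types (f a : G -> R).

Lemma convolutionE f a (s : seq G) : uniq s -> (forall x, (x \in s) = (f x != 0)) ->
  convolution f a = fun x => \sum_(y <- s) f y * a (y^-1 * x)%g.
Proof.
move=> us sf; apply/funext => x; rewrite /convolution -[LHS]/(gsum _).
by apply: gsumE => // y; rewrite sf; apply: contra_neq => ->; rewrite mul0r.
Qed.

Lemma gsum_convolution f a : finsupp f -> finsupp a ->
  gsum (convolution f a) = gsum f * gsum a.
Proof.
move=> ff fa; have [s us sf] := finsupp_list ff.
rewrite (convolutionE _ us sf) gsum_sum; last first.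
  move=> y; apply: finsupp_sub (finsupp_translate y^-1%g fa) => x ->.
  by rewrite mulr0.
rewrite (gsumE us); last by move=> x; rewrite sf.
rewrite mulr_suml; apply: eq_bigr => y _.
by rewrite gsumZ ?gsum_translate//; exact: finsupp_translate.
Qed.

End Convolution.

Section Energy.
Context (R : realType) (G : groupType) (mu : finprob R G).
Hypothesis mu1 : 0 < mu 1%g.

Let finmu : finsupp mu := pmf_fin mu.

Lemma pmf_gt0 h : mu h != 0 -> 0 < mu h.
Proof. by move=> h0; rewrite lt_neqAle eq_sym h0 Defs.pmf_ge0. Qed.

Lemma gsum_pmf : gsum mu = 1. Proof. exact: pmf_sum1. Qed.

Definition walk (n : nat) : G -> R := convolution_pow mu n.

Lemma finsupp_walk n : finsupp (walk n).
Proof. exact/convolution_pow_fin/pmf_fin. Qed.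

Lemma walkS n : walk n.+1 = convolution mu (walk n). Proof. by []. Qed.

Lemma walk_ge0 n x : 0 <= walk n x.
Proof.
elim: n x => [|n IHn] x; first exact: ler0n.
by rewrite walkS; apply: gsum_ge0 => y; rewrite mulr_ge0// Defs.pmf_ge0.
Qed.

Lemma gsum_walk n : gsum (walk n) = 1.
Proof.
elim: n => [|n IHn].
  rewrite (@gsumE _ _ _ [:: 1%g])// ?big_seq1 /walk /= ?eqxx// => x.
  by rewrite inE; case: (x =P 1%g); rewrite ?eqxx.
by rewrite walkS gsum_convolution ?gsum_pmf ?mul1r//; exact: finsupp_walk.
Qed.

Lemma walkS_ge n y x : mu y * walk n (y^-1 * x)%g <= walk n.+1 x.
Proof.
have [s us sf] := finsupp_list finmu.
have [->|y0] := eqVneq (mu y) 0; first by rewrite mul0r walk_ge0.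
rewrite walkS (convolutionE _ us sf) (bigD1_seq y)//=; last by rewrite sf.
by rewrite lerDl sumr_ge0// => z _; rewrite mulr_ge0 ?Defs.pmf_ge0 ?walk_ge0.
Qed.

Lemma walkS_gt0 n y x : mu y != 0 -> walk n (y^-1 * x)%g != 0 -> walk n.+1 x != 0.
Proof.
move=> y0 x0; rewrite gt_eqF// (lt_le_trans _ (walkS_ge n y x))// mulr_gt0//.
  exact: pmf_gt0.
by rewrite lt_neqAle eq_sym x0 walk_ge0.
Qed.

Lemma walk_supp (B : nat -> set G) (l : nat) :
  (forall n, B n 1%g) -> (forall m n g h, B m g -> B n h -> B (m + n)%N (g * h)%g) ->
  (forall x, mu x != 0 -> B l x) -> forall n x, walk n x != 0 -> B (n * l)%N x.
Proof.
move=> B1 BM Bmu; elim=> [|n IHn] x.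
  by rewrite /walk /=; case: (x =P 1%g) => [-> _|_]; rewrite ?eqxx.
have [s us sf] := finsupp_list finmu.
rewrite walkS (convolutionE _ us sf) => /eqP h; have : exists2 y, y \in s &
    mu y * walk n (y^-1 * x)%g != 0.
  apply: contrapT => nh; apply: h; rewrite big_seq big1// => y ys; apply/eqP.
  by apply: contrapT => /negP yx; apply: nh; exists y.
move=> [y]; rewrite sf mulf_eq0 negb_or => y0 /andP[_ /IHn hx].
by rewrite mulSn -[x](mulKVg y); apply: BM => //; exact: Bmu.
Qed.

Definition energy (b : R -> R) (a : G -> R) (h : G) : R :=
  gsum (fun x => (b (a x) - b (a (h^-1 * x)%g)) ^+ 2).

(** Summing over the support yields a single constant for all [h] charged by [mu]. *)
Definition energy_cst : R := \sum_(y <- fset_set [set x | mu x != 0]) (2 / mu y + 2 / mu 1%g).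

(* [psi] is convex, with [t m] the slope at m, and its convexity controls [b]. *)
Definition dominates (psi b t : R -> R) : Prop :=
  [/\ psi 0 = 0, b 0 = 0 & forall x m, 0 <= x -> 0 <= m -> (m = 0 -> x = 0) ->
    (b x - b m) ^+ 2 <= psi x - psi m - t m * (x - m)].

Section Dominates.
Context (psi b t : R -> R) (psib : dominates psi b t).

Let finpsi (a : G -> R) : finsupp a -> finsupp (psi \o a).
Proof. by have [p0 _ _] := psib; apply: finsupp_sub => x /= ->. Qed.
Let finb (a a' : G -> R) : finsupp a -> finsupp a' -> finsupp (fun x => (b (a x) - b (a' x)) ^+ 2).
Proof.
move=> fa fa'; have [s [us sa sa']] := finsupp2 fa fa'; apply/finsuppP; exists s => x.
have [_ b0 _] := psib; apply: contraR => xs; apply/eqP.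
by rewrite (eqP (contraR (sa x) xs)) (eqP (contraR (sa' x) xs)) subrr expr0n.
Qed.

(** The next step of the walk is the [mu]-average of translates of [walk n], so the drop of the sum
    of [psi] is a sum of Jensen deficits. The term of [h], of weight [mu h], controls the square. *)
Lemma energy_step n h : mu h * gsum (fun x => (b (walk n (h^-1 * x)%g) - b (walk n.+1 x)) ^+ 2)
  <= gsum (psi \o walk n) - gsum (psi \o walk n.+1).
Proof.
have [p0 b0 psiP] := psib.
have [s us sf] := finsupp_list finmu.
have fw := finsupp_walk n; have fw' := finsupp_walk n.+1.
have fy y : finsupp (fun x => walk n (y^-1 * x)%g) by exact: finsupp_translate.
have fpy y : finsupp (fun x => mu y * psi (walk n (y^-1 * x)%g)).
  by apply: finsupp_sub (fy y) => x ->; rewrite p0 mulr0.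
have s1 : \sum_(y <- s) mu y = 1.
  by rewrite -gsum_pmf (gsumE us)// => x; rewrite sf.
rewrite -gsumZ; last exact: finb.
have -> : gsum (psi \o walk n) = gsum (fun x => \sum_(y <- s) mu y * psi (walk n (y^-1 * x)%g)).
  rewrite gsum_sum//; under eq_bigr => y _.
    rewrite gsumZ; last by apply: finsupp_sub (fy y) => x ->; rewrite p0.
    rewrite (gsum_translate y^-1%g (psi \o walk n)); over.
  by rewrite -mulr_suml s1 mul1r.
rewrite -gsumB; [|exact: finsupp_sum|exact: finpsi].
apply: ler_gsum.
- by apply: finsupp_sub (finb (fy h) fw') => x ->; rewrite mulr0.
- by apply: finsuppB; [exact: finsupp_sum|exact: finpsi].
move=> x /=.
have walkE : walk n.+1 x = \sum_(y <- s) mu y * walk n (y^-1 * x)%g.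
  by rewrite walkS (convolutionE _ us sf).
set m := walk n.+1 x in walkE *.
(* The tangent term can be inserted because its average vanishes. *)
have -> : \sum_(y <- s) mu y * psi (walk n (y^-1 * x)%g) - psi m =
    \sum_(y <- s) mu y * (psi (walk n (y^-1 * x)%g) - psi m - t m * (walk n (y^-1 * x)%g - m)).
  transitivity (\sum_(y <- s) (mu y * psi (walk n (y^-1 * x)%g) -
     (psi m - t m * m) * mu y - t m * (mu y * walk n (y^-1 * x)%g))); last first.
    by apply: eq_bigr => y _; ring.
  by rewrite !sumrB -!mulr_sumr s1 -walkE; ring.
have nn y : y \in s -> 0 <= mu y * (psi (walk n (y^-1 * x)%g) - psi m -
    t m * (walk n (y^-1 * x)%g - m)) /\ mu y * (b (walk n (y^-1 * x)%g) - b m) ^+ 2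
    <= mu y * (psi (walk n (y^-1 * x)%g) - psi m - t m * (walk n (y^-1 * x)%g - m)).
  rewrite sf => y0.
  have := psiP (walk n (y^-1 * x)%g) m (walk_ge0 _ _) (walk_ge0 _ _).
  move=> /(_ _)/[dup] hP; split.
    rewrite mulr_ge0 ?Defs.pmf_ge0// (le_trans (sqr_ge0 _) (hP _))// => m0.
    by apply/eqP; apply: contra_eqT m0 => /(walkS_gt0 y0).
  rewrite ler_wpM2l ?Defs.pmf_ge0// hP// => m0.
  by apply/eqP; apply: contra_eqT m0 => /(walkS_gt0 y0).
have [hs|] := boolP (h \in s); last first.
  rewrite sf negbK => /eqP ->; rewrite mul0r big_seq sumr_ge0// => y /nn[].
  by [].
rewrite (bigD1_seq h)//= -[leLHS]addr0 lerD//; first by have [] := nn h hs.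
by rewrite big_seq_cond sumr_ge0// => y /andP[/nn[]].
Qed.

(** Both [walk n] and its translate are compared with [walk n.+1], through the steps 1 and [h];
    [mu1] makes the first comparison possible. *)
Lemma energy_le n h : mu h != 0 ->
  energy b (walk n) h <= energy_cst * (gsum (psi \o walk n) - gsum (psi \o walk n.+1)).
Proof.
move=> h0; have hp := pmf_gt0 h0.
have e1 := energy_step n 1%g; have eh := energy_step n h.
set D := gsum _ - gsum _ in e1 eh *.
have D0 : 0 <= D.
  by apply: le_trans e1; rewrite mulr_ge0 ?Defs.pmf_ge0// gsum_ge0// => x; exact: sqr_ge0.
apply: (@le_trans _ _ ((2 / mu h + 2 / mu 1%g) * D)); last first.
  rewrite ler_wpM2r// /energy_cst (bigD1_seq h) ?fset_uniq//=; last first.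
    by rewrite in_fset_set ?mem_setE.
  by rewrite lerDl sumr_ge0// => y _; rewrite addr_ge0// divr_ge0// Defs.pmf_ge0.
have fw := finsupp_walk n; have fw' := finsupp_walk n.+1.
have fy y : finsupp (fun x => walk n (y^-1 * x)%g) by exact: finsupp_translate.
have fd y : finsupp (fun x => 2 * (b (walk n (y^-1 * x)%g) - b (walk n.+1 x)) ^+ 2).
  by apply: finsupp_sub (finb (fy y) fw') => x ->; rewrite mulr0.
apply: (@le_trans _ _ (gsum (fun x => 2 * (b (walk n (h^-1 * x)%g) - b (walk n.+1 x)) ^+ 2 +
   2 * (b (walk n (1^-1 * x)%g) - b (walk n.+1 x)) ^+ 2))).
  apply: ler_gsum => [||x]; [exact: finb|exact: finsuppD|].
  rewrite invg1 mul1g; set u := b _; set v := b _; set w := b _.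
  by rewrite -subr_ge0 (_ : _ - _ = (u + v - 2 * w) ^+ 2) ?sqr_ge0//; ring.
rewrite gsumD// !gsumZ; [|exact: finb|exact: finb].
rewrite [leRHS]mulrDl; apply: lerD.
- by rewrite -mulrA ler_pM2l// ler_pdivlMl.
- by rewrite -mulrA ler_pM2l// ler_pdivlMl.
Qed.
End Dominates.

End Energy.

Lemma ln_leB1 (R : realType) (u : R) : 0 < u -> ln u <= u - 1.
Proof.
move=> u0; have := @le_ln1Dx R (u - 1).
by rewrite (_ : 1 + (u - 1) = u); [apply; lra|ring].
Qed.

(** * Convex functions controlling squares of differences *)

Section Potentials.
Context (R : realType).

Lemma dominates_sqr : @dominates R (fun x => x ^+ 2) id (fun m => 2 * m).
Proof. by split=> [||x m _ _ _]; rewrite ?expr0n//; lra. Qed.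

Lemma dominates_exp4 :
  @dominates R (fun x => x ^+ 4) (fun x => x ^+ 2) (fun m => 4 * m ^+ 3).
Proof.
split=> [||x m _ _ _]; rewrite ?expr0n// -subr_ge0.
rewrite (_ : _ - _ = 2 * (m * (x - m)) ^+ 2); last by ring.
by rewrite mulr_ge0 ?sqr_ge0.
Qed.

(** With [u = sqrt x] and [v = sqrt m] this reduces to [ln (v / u) <= v / u - 1]. *)
Lemma dominates_entropy :
  @dominates R (fun x => x * ln x) Num.sqrt (fun m => 1 + ln m).
Proof.
split=> [||x m x0 m0 xm] /=; rewrite ?mul0r ?sqrtr0//.
have [m00|mn0] := eqVneq m 0.
  by rewrite m00 (xm m00) !subrr expr0n mulr0 subr0.
have {}m0 : 0 < m by rewrite lt_neqAle eq_sym mn0.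
have [->|xn0] := eqVneq x 0.
  rewrite sqrtr0 mul0r !sub0r sqrrN sqr_sqrtr; [lra|exact: ltW].
have {}x0 : 0 < x by rewrite lt_neqAle eq_sym xn0.
set u := Num.sqrt x; set v := Num.sqrt m.
have u0 : 0 < u by rewrite sqrtr_gt0.
have v0 : 0 < v by rewrite sqrtr_gt0.
have -> : x = u ^+ 2 by rewrite sqr_sqrtr// ltW.
have -> : m = v ^+ 2 by rewrite sqr_sqrtr// ltW.
rewrite !expr2 !lnM ?posrE//.
have := ln_leB1 (divr_gt0 v0 u0); rewrite ln_div ?posrE// => h.
have {}h : u ^+ 2 * (ln v - ln u) <= u * v - u ^+ 2.
  apply: le_trans (ler_wpM2l (sqr_ge0 u) h) _.
  by rewrite le_eqVlt; apply/orP; left; apply/eqP; field; rewrite gt_eqF.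
nra.
Qed.

End Potentials.

(** * Potentials along the walk *)

Section Upper.
Context (R : realType) (G : groupType) (mu : finprob R G).
Hypothesis mu1 : 0 < mu 1%g.
Local Notation walk := (walk mu).

Let M r n := gsum (fun x => walk n x ^+ r).

Let finM r n : finsupp (fun x => walk n x ^+ r.+1).
Proof. by apply: finsupp_sub (finsupp_walk mu n) => x ->; rewrite expr0n. Qed.

Lemma walk_gt0 n : exists x, 0 < walk n x.
Proof.
apply: contrapT => h; have := gsum_walk mu n.
rewrite (_ : walk n = fun=> 0) ?gsum0 => [/eqP|]; first by rewrite eq_sym oner_eq0.
apply/funext => x; apply/eqP; apply: contrapT => /negP x0; apply: h; exists x.
by rewrite lt_neqAle eq_sym x0 walk_ge0.
Qed.

Lemma size_supp_gt0 n (T : seq G) : (forall x, walk n x != 0 -> x \in T) -> (0 < size T)%N.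
Proof.
move=> hT; have [x x0] := walk_gt0 n.
by have := hT x; rewrite gt_eqF// => /(_ isT); case: T {hT}.
Qed.

Lemma walk_peak n (T : seq G) : (forall x, walk n x != 0 -> x \in T) ->
  exists x, (size T)%:R^-1 <= walk n x.
Proof.
move=> hT; have T0 := size_supp_gt0 hT.
apply: contrapT => h; have := gsum_walk mu n.
rewrite (@gsumE _ _ _ (undup T)) ?undup_uniq//; last by move=> x /hT; rewrite mem_undup.
have T0' : has xpredT (undup T).
  have [x x0] := walk_gt0 n; apply/hasP; exists x => //.
  by rewrite mem_undup hT// gt_eqF.
move=> /eqP; apply/negP; rewrite lt_eqF//.
apply: (@lt_le_trans _ _ (\sum_(x <- undup T) (size T)%:R^-1)).
  apply: ltr_sum => // x _; rewrite ltNge; apply/negP => hx; apply: h; by exists x.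
rewrite big_const_seq count_predT iter_addr_0 -[leLHS]mulr_natl ler_pdivrMr ?ltr0n//.
by rewrite mul1r ler_nat size_undup.
Qed.

Let M_gt0 r n : 0 < M r.+1 n.
Proof.
have [x x0] := walk_gt0 n; apply: (@gsum_gt0 _ _ _ x) => //.
- by move=> y; rewrite exprn_ge0// walk_ge0.
- exact: exprn_gt0.
Qed.

Let M_0 r : M r.+1 0 = 1.
Proof.
rewrite /M (@gsumE _ _ _ [:: 1%g])// ?big_seq1 /walk /= ?eqxx ?expr1n// => x.
by rewrite inE; case: (x =P 1%g) => // _; rewrite expr0n eqxx.
Qed.

Let M_ge r N (T : seq G) : (forall x, walk N x != 0 -> x \in T) ->
  - ln (M r.+1 N) <= r.+1%:R * ln (size T)%:R.
Proof.
move=> hT; have T0 := size_supp_gt0 hT; have [x hx] := walk_peak hT.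
have T0' : 0 < (size T)%:R :> R by rewrite ltr0n.
rewrite lerNl -mulrN -lnV ?posrE// mulr_natl -lnXn ?invr_gt0//.
rewrite ler_ln ?posrE ?exprn_gt0 ?invr_gt0//.
apply: (@le_trans _ _ (walk N x ^+ r.+1)).
  by rewrite lerXn2r ?nnegrE ?invr_ge0 ?walk_ge0.
have [s us sf] := finsupp_list (finsupp_walk mu N).
rewrite /M (gsumE us); last by move=> y; rewrite sf; apply: contra_neq => ->; rewrite expr0n.
rewrite (bigD1_seq x)//=; last by rewrite sf gt_eqF// (lt_le_trans _ hx)// invr_gt0.
by rewrite lerDl sumr_ge0// => y _; rewrite exprn_ge0// walk_ge0.
Qed.

(** [rho n] is meant as the increment of a potential; the last clause bounds its telescoped sum. *)
Definition energy_bound (b : R -> R) (rho : nat -> R) : Prop :=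
  [/\ forall n, 0 <= rho n,
      forall n h, mu h != 0 ->
        energy b (walk n) h <= rho n * gsum (fun x => b (walk n x) ^+ 2) &
      exists2 C, 0 <= C & forall N (T : seq G), (forall x, walk N x != 0 -> x \in T) ->
        \sum_(0 <= n < N) rho n <= C * ln (size T)%:R].

Lemma energy_cst_ge0 : 0 <= energy_cst mu.
Proof. by apply: sumr_ge0 => y _; rewrite addr_ge0// divr_ge0// Defs.pmf_ge0. Qed.

(** The inequality [1 - y <= - ln y], at the ratio of consecutive values of [M], turns the relative
    drop of [M] into a drop of [ln M], which telescopes from [ln 1 = 0]. *)
Lemma energy_bound_exp b t r : dominates (fun x => x ^+ (2 * r.+1)) b t ->
  (forall x, b x = x ^+ r.+1) -> exists rho, energy_bound b rho.
Proof.
move=> dom bE; set r' := (2 * r.+1)%N in dom.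
have r'S : r' = r'.-1.+1 by rewrite prednK.
have C0 := energy_cst_ge0.
have step n h : mu h != 0 -> energy b (walk n) h <= energy_cst mu * (M r' n - M r' n.+1).
  by move=> h0; exact: energy_le dom _ _ h0.
have lnM n : M r' n - M r' n.+1 <= M r' n * (ln (M r' n) - ln (M r' n.+1)).
  have Mn : 0 < M r' n by rewrite r'S.
  have MSn : 0 < M r' n.+1 by rewrite r'S.
  have := ln_leB1 (divr_gt0 MSn Mn); rewrite ln_div ?posrE// => h.
  rewrite -[X in X <= _](_ : M r' n * (1 - M r' n.+1 / M r' n) = _).
    by apply: ler_wpM2l; [exact: ltW|lra].
  by field; rewrite gt_eqF.
have mu1' : mu 1%g != 0 by rewrite gt_eqF.
pose d n := ln (M r' n) - ln (M r' n.+1).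
have e0 n : 0 <= energy_cst mu * d n.
  have [e00|en0] := eqVneq (energy_cst mu) 0; first by rewrite e00 mul0r.
  rewrite mulr_ge0//; have : 0 <= M r' n - M r' n.+1.
    rewrite -(pmulr_rge0 _ (_ : 0 < energy_cst mu)); last by rewrite lt_neqAle eq_sym en0.
    by apply: le_trans (step n _ mu1'); apply: gsum_ge0 => x; exact: sqr_ge0.
  move=> /le_trans /(_ (lnM n)); rewrite pmulr_rge0//; by rewrite r'S.
exists (fun n => energy_cst mu * d n); split => //.
- move=> n h h0; apply: le_trans (step n h h0) _.
  rewrite -mulrA ler_wpM2l// mulrC.
  have -> : gsum (fun x => b (walk n x) ^+ 2) = M r' n.
    by apply: eq_gsum => x; rewrite bE -exprM mulnC.
  exact: lnM.
- exists (energy_cst mu * r'%:R); first by rewrite mulr_ge0.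
  move=> N T hT; rewrite -mulr_sumr -mulrA ler_wpM2l//.
  rewrite /d; under eq_bigr do rewrite -opprB.
  rewrite sumrN telescope_sumr// opprB {1}r'S M_0 ln1 sub0r r'S.
  exact: M_ge.
Qed.

(** The total mass is 1, so the increments of the entropy serve directly, and the entropy is at most
    the logarithm of the size of the support. *)
Lemma energy_bound_entropy : exists rho, energy_bound Num.sqrt rho.
Proof.
pose H n := gsum (fun x => walk n x * ln (walk n x)).
have C0 := energy_cst_ge0.
have step n h : mu h != 0 ->
    energy Num.sqrt (walk n) h <= energy_cst mu * (H n - H n.+1).
  by move=> h0; exact: energy_le (dominates_entropy R) _ _ h0.
have mu1' : mu 1%g != 0 by rewrite gt_eqF.
exists (fun n => energy_cst mu * (H n - H n.+1)); split.
- move=> n; apply: le_trans (step n _ mu1').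
  by apply: gsum_ge0 => x; exact: sqr_ge0.
- move=> n h /step; have -> : gsum (fun x => Num.sqrt (walk n x) ^+ 2) = 1; last by rewrite mulr1.
  by rewrite -[RHS](gsum_walk mu n); apply: eq_gsum => x; rewrite sqr_sqrtr// walk_ge0.
exists (energy_cst mu) => // N T hT; rewrite -mulr_sumr ler_wpM2l//.
under eq_bigr do rewrite -opprB.
rewrite sumrN telescope_sumr// opprB.
have -> : H 0%N = 0.
  rewrite /H -[RHS](gsum0 R G); apply: eq_gsum => x; rewrite /walk /=.
  by case: (x == 1%g); rewrite ?ln1 ?mulr0 ?mul0r.
rewrite sub0r /H; have T0 := size_supp_gt0 hT.
have T0' : 0 < (size T)%:R :> R by rewrite ltr0n.
rewrite lerNl (@gsumE _ _ _ (undup T)) ?undup_uniq//; last first.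
  by move=> x; rewrite mem_undup => xT; apply: hT; apply: contra_neq xT => ->; rewrite mul0r.
have s1 : \sum_(x <- undup T) walk N x = 1.
  by rewrite -(gsum_walk mu N) (gsumE (undup_uniq T))// => x /hT; rewrite mem_undup.
have -> : - ln (size T)%:R = \sum_(x <- undup T) (walk N x * - ln (size T)%:R) :> R.
  by rewrite -mulr_suml s1 mul1r.
rewrite -subr_ge0 -sumrB.
(* Gibbs' inequality against the constant [1 / size T], whose sum over [undup T] is at most 1. *)
apply: (@le_trans _ _ (\sum_(x <- undup T) (walk N x - (size T)%:R^-1))).
  rewrite sumrB s1 big_const_seq count_predT iter_addr_0 subr_ge0.
  by rewrite -[leLHS]mulr_natl ler_pdivrMr// mul1r ler_nat size_undup.
apply: ler_sum => x _; set u := walk N x.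
have := walk_ge0 mu N x; rewrite -/u le_eqVlt => /predU1P[<-|u0].
  by rewrite !mul0r subrr sub0r oppr_le0 invr_ge0 ltW.
have := ln_leB1 (divr_gt0 (_ : 0 < (size T)%:R^-1) u0).
rewrite invr_gt0 => /(_ T0'); rewrite ln_div ?posrE ?invr_gt0// lnV ?posrE// => h.
have := ler_wpM2l (ltW u0) h.
have -> : u * ((size T)%:R^-1 / u - 1) = (size T)%:R^-1 - u by field; rewrite !gt_eqF.
lra.
Qed.

End Upper.

(** Passage between the l_1 displacement of [f ^+ 2] and the l_2 displacement of [f]. It serves the
    upper bound for [P = 1] and the lower bound for [P = 2]. *)
Lemma gsum_sqr_diff (R : realType) (G : groupType) (f : G -> R) (h : G) (eta : R) :
  finsupp f -> 0 < eta ->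
  gsum (fun x => `|f x ^+ 2 - f (h^-1 * x)%g ^+ 2|) <=
  2 * eta * gsum (fun x => f x ^+ 2) +
  (2 * eta)^-1 * gsum (fun x => (f x - f (h^-1 * x)%g) ^+ 2).
Proof.
move=> ff e0.
have fh : finsupp (fun x => f (h^-1 * x)%g) by exact: finsupp_translate.
have fsq (u : G -> R) : finsupp u -> finsupp (fun x => u x ^+ 2).
  by apply: finsupp_sub => x ->; rewrite expr0n.
have fZ c (u : G -> R) : finsupp u -> finsupp (fun x => c * u x).
  by apply: finsupp_sub => x ->; rewrite mulr0.
have ff2 := fsq _ ff; have fh2 := fsq _ fh; have fe := fsq _ (finsuppB ff fh).
have -> : 2 * eta * gsum (fun x => f x ^+ 2) =
    gsum (fun x => eta * f x ^+ 2 + eta * f (h^-1 * x)%g ^+ 2).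
  rewrite gsumD ?gsumZ//; [|exact: fZ|exact: fZ].
  by rewrite (gsum_translate h^-1%g (fun x => f x ^+ 2)); ring.
rewrite -gsumZ// -gsumD; [|by apply: finsuppD; exact: fZ|exact: fZ].
apply: ler_gsum => [||x].
- by apply: finsupp_sub (finsuppB ff2 fh2) => x ->; rewrite normr0.
- by apply: finsuppD; [apply: finsuppD; exact: fZ|exact: fZ].
set u := f x; set v := f _.
(* AM-GM for |u - v| |u + v| *)
have key : 0 <= (2 * eta)^-1 * (`|u - v| - eta * `|u + v|) ^+ 2.
  by rewrite mulr_ge0 ?sqr_ge0// invr_ge0 mulr_ge0// ltW.
have nE : `|u ^+ 2 - v ^+ 2| = `|u - v| * `|u + v| by rewrite subr_sqr normrM.
have dE : (u - v) ^+ 2 = `|u - v| ^+ 2 by rewrite real_normK ?num_real.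
have sE : (u + v) ^+ 2 = `|u + v| ^+ 2 by rewrite real_normK ?num_real.
have : (2 * eta)^-1 * (`|u - v| - eta * `|u + v|) ^+ 2 =
    (2 * eta)^-1 * (u - v) ^+ 2 - `|u ^+ 2 - v ^+ 2| + eta / 2 * (u + v) ^+ 2.
  by rewrite dE sE nE; field; rewrite gt_eqF.
have : eta / 2 * (u + v) ^+ 2 = eta * u ^+ 2 + eta * v ^+ 2 - eta / 2 * (u - v) ^+ 2.
  by field.
have : 0 <= eta / 2 * (u - v) ^+ 2 by rewrite mulr_ge0 ?sqr_ge0// divr_ge0// ltW.
lra.
Qed.

Section Slow.
Context (R : realType) (G : groupType) (mu : finprob R G).
Hypothesis mu1 : 0 < mu 1%g.
Local Notation walk := (walk mu).

(* At the times n where [rho n] is small, the powers of [walk n] are almost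
   invariant in l_P; there are many such times if the group grows slowly. *)
Definition almost_invariant (P q : nat) (rho : nat -> R) : Prop :=
  [/\ forall n, 0 <= rho n,
      exists2 C, 0 <= C & forall N (T : seq G), (forall x, walk N x != 0 -> x \in T) ->
        \sum_(0 <= n < N) rho n <= C * ln (size T)%:R &
      forall n eta h, 0 < eta <= 1 -> rho n <= eta ^+ 2 -> mu h != 0 ->
        gsum (fun x => `|pow0 q (walk n) x - pow0 q (walk n) (h^-1 * x)%g| ^+ P) <=
        (3 * eta) ^+ P * gsum (fun x => `|pow0 q (walk n) x| ^+ P)].

Lemma energy_bound_inv2 b rho q : energy_bound mu b rho ->
  (forall n x, pow0 q (walk n) x = b (walk n x)) -> almost_invariant 2 q rho.
Proof.
move=> [rho0 rhoE rhoC] qb; split=> // n eta h /andP[e0 e1] re h0.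
under eq_gsum do rewrite !qb real_normK ?num_real//.
under [in leRHS]eq_gsum do rewrite !qb real_normK ?num_real//.
apply: le_trans (rhoE n h h0) _; apply: ler_wpM2r.
  by apply: gsum_ge0 => x; exact: sqr_ge0.
apply: le_trans re _; rewrite exprMn ler_peMl ?sqr_ge0//.
by rewrite expr2; lra.
Qed.

(** [gsum_sqr_diff] gives the factor [2 eta + eta / 2], which is below [3 eta]. *)
Lemma energy_bound_inv1 b rho q : b 0 = 0 -> energy_bound mu b rho ->
  (forall n x, pow0 q (walk n) x = b (walk n x) ^+ 2) -> almost_invariant 1 q rho.
Proof.
move=> b0 [rho0 rhoE rhoC] qb; split=> // n eta h /andP[e0 e1] re h0.
under eq_gsum do rewrite !qb expr1.
under [in leRHS]eq_gsum do rewrite !qb !expr1 ger0_norm ?sqr_ge0//.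
set M := gsum (fun x => b (walk n x) ^+ 2).
have M0 : 0 <= M by apply: gsum_ge0 => x; exact: sqr_ge0.
have E := rhoE n h h0; rewrite -/M in E.
have fb : finsupp (b \o walk n).
  by apply: finsupp_sub (finsupp_walk mu n) => x /= ->.
apply: le_trans (gsum_sqr_diff h fb e0) _; rewrite -/M.
have h1 : (2 * eta)^-1 * energy b (walk n) h <= eta / 2 * M.
  apply: (@le_trans _ _ ((2 * eta)^-1 * (eta ^+ 2 * M))).
    apply: ler_wpM2l; first by rewrite invr_ge0 mulr_ge0// ltW.
    by apply: le_trans E _; rewrite ler_wpM2r.
  by rewrite le_eqVlt; apply/orP; left; apply/eqP; field; rewrite gt_eqF.
have : 0 <= eta * M by rewrite mulr_ge0// ltW.
rewrite /energy in h1; move: h1 => /=; rewrite -/M; lra.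
Qed.

(** For [q = 0] the functions are indicators. The support at time [n] and its translate by [h] both
    lie in the support at time [n + 1], so they differ on at most [2 (K n.+1 - K n)] points; the
    potential is [ln K]. *)
Lemma almost_invariant_supp P : P \in [:: 1; 2]%N ->
  exists rho, almost_invariant P 0 rho.
Proof.
move=> hP.
pose F n := pow0 0 (walk n).
have FE n x : F n x = (walk n x != 0)%:R by rewrite /F /pow0; case: eqP.
pose K n := gsum (F n).
have fF n : finsupp (F n).
  by apply: finsupp_sub (finsupp_walk mu n) => x wx; rewrite FE wx eqxx.
have K0 n : 0 < K n.
  have [x x0] := walk_gt0 mu n; apply: (@gsum_gt0 _ _ _ x) => //.
    by move=> y; rewrite FE.
  by rewrite FE gt_eqF.
have [s us sf] := finsupp_list (pmf_fin mu : finsupp mu).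
have mu1' : mu 1%g != 0 by rewrite gt_eqF.
have fFh n y : finsupp (fun x => F n (y^-1 * x)%g) by exact: finsupp_translate.
have Fmono n y x : mu y != 0 -> F n (y^-1 * x)%g <= F n.+1 x.
  move=> y0; rewrite !FE; case: (boolP (walk n (y^-1 * x)%g != 0)) => // h.
  by rewrite (walkS_gt0 y0 h).
have Fmono1 n x : F n x <= F n.+1 x by have := Fmono n 1%g x mu1'; rewrite invg1 mul1g.
(* The increment of [ln K] controls that of [K] relative to [K n.+1]; this makes it relative to
   [K n]. *)
have Kgrow n : K n.+1 <= (size s)%:R * K n.
  rewrite [leRHS](_ : _ = gsum (fun x => \sum_(y <- s) F n (y^-1 * x)%g)); last first.
    rewrite gsum_sum//; under eq_bigr do rewrite gsum_translate.
    by rewrite big_const_seq count_predT iter_addr_0 mulr_natl.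
  apply: ler_gsum => [||x]; [exact: fF|exact: finsupp_sum|].
  rewrite FE; have [_|] := eqVneq (walk n.+1 x) 0.
    by apply: sumr_ge0 => y _; rewrite FE.
  rewrite walkS (convolutionE _ us sf) => /eqP h.
  have [y ys yx] : exists2 y, y \in s & walk n (y^-1 * x)%g != 0.
    apply: contrapT => nh; apply: h; rewrite big_seq big1// => y ys.
    have [->|yx] := eqVneq (walk n (y^-1 * x)%g) 0; first by rewrite mulr0.
    by case: nh; exists y.
  rewrite (bigD1_seq y)//= FE yx lerDl; apply: sumr_ge0 => z _; by rewrite FE.
have Kmono n : K n <= K n.+1 by apply: ler_gsum.
have KS n : K n.+1 - K n <= (size s)%:R * (ln (K n.+1) - ln (K n)) * K n.
  have := ln_leB1 (divr_gt0 (K0 n) (K0 n.+1)); rewrite ln_div ?posrE// => h.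
  have h1 : K n.+1 - K n <= K n.+1 * (ln (K n.+1) - ln (K n)).
    rewrite -[leLHS](_ : K n.+1 * (1 - K n / K n.+1) = _).
      by apply: ler_wpM2l; [exact: ltW|lra].
    by field; rewrite gt_eqF.
  apply: le_trans h1 _; rewrite mulrAC ler_wpM2r//.
  by rewrite subr_ge0 ler_ln ?posrE.
have gN n h : mu h != 0 -> gsum (fun x => `|F n x - F n (h^-1 * x)%g| ^+ P) <= 2 * (K n.+1 - K n).
  move=> h0; have -> : gsum (fun x => `|F n x - F n (h^-1 * x)%g| ^+ P) =
      gsum (fun x => `|F n x - F n (h^-1 * x)%g|).
    apply: eq_gsum => x; rewrite !FE.
    by move: hP; rewrite !inE => /orP[]/eqP ->; case: eqP; case: eqP => _ _ /=;
      rewrite ?subrr ?normr0 ?subr0 ?sub0r ?normrN ?normr1 ?expr1n ?expr0n.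
  apply: (@le_trans _ _ (gsum (fun x => (F n.+1 x - F n x) + (F n.+1 x - F n (h^-1 * x)%g)))).
    apply: ler_gsum => [||x].
    - apply: (@finsupp_sub _ _ _ (fun x => F n x - F n (h^-1 * x)%g)).
        by move=> x ->; rewrite normr0.
      exact: finsuppB.
    - by apply: finsuppD; exact: finsuppB.
    have := Fmono n h x h0; have := Fmono1 n x.
    rewrite ler_norml => ? ?; apply/andP; split; lra.
  rewrite gsumD; [|exact: finsuppB|exact: finsuppB].
  by rewrite !gsumB// (gsum_translate h^-1%g (F n)) -/(K n) -/(K n.+1); lra.
exists (fun n => 2 * (size s)%:R * (ln (K n.+1) - ln (K n))); split.
- by move=> n; rewrite !mulr_ge0// subr_ge0 ler_ln ?posrE.
- exists (2 * (size s)%:R); first exact: mulr_ge0.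
  move=> N T hT; rewrite -mulr_sumr; apply: ler_wpM2l; first exact: mulr_ge0.
  rewrite telescope_sumr//.
  have -> : K 0%N = 1.
    rewrite /K (@gsumE _ _ _ [:: 1%g])//.
      by rewrite big_seq1 FE /walk /= eqxx oner_eq0.
    by move=> x; rewrite FE inE /walk /=; case: (x =P 1%g) => // _; rewrite !eqxx.
  rewrite ln1 subr0 ler_ln ?posrE// ?ltr0n ?(size_supp_gt0 hT)//.
  rewrite /K (@gsumE _ _ _ (undup T)) ?undup_uniq//; last first.
    by move=> x; rewrite FE mem_undup pnatr_eq0 eqb0 negbK => /hT.
  apply: (@le_trans _ _ (\sum_(x <- undup T) 1)).
    by apply: ler_sum => x _; rewrite FE; case: eqP.
  by rewrite big_const_seq count_predT iter_addr_0 ler_nat size_undup.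
- move=> n eta h /andP[e0 e1] re h0; apply: le_trans (gN n h h0) _.
  have -> : gsum (fun x => `|pow0 0 (walk n) x| ^+ P) = K n.
    apply: eq_gsum => x; rewrite -/(F n x) FE normr_nat -natrX.
    by move: hP; rewrite !inE => /orP[]/eqP ->; case: eqP.
  have h2 : 2 * (K n.+1 - K n) <= eta ^+ 2 * K n.
    apply: (@le_trans _ _ (2 * (size s)%:R * (ln (K n.+1) - ln (K n)) * K n)).
      by rewrite -!mulrA ler_pM2l// !mulrA.
    by rewrite ler_wpM2r// ltW.
  apply: le_trans h2 _; rewrite ler_wpM2r ?ltW//.
  move: hP; rewrite !inE => /orP[]/eqP ->; rewrite ?expr1 ?expr2; nra.
Qed.

(** For [q > 0] the potential is dictated by [P q]: entropy for 1, squares for 2, fourth powers for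
    4. *)
Lemma almost_invariant_ex P q : P \in [:: 1; 2]%N -> q \in [:: 0; 1; 2]%N ->
  exists rho, almost_invariant P q rho.
Proof.
have p1E n x : pow0 1 (walk n) x = walk n x by rewrite /pow0; case: eqP => [->|].
have p2E n x : pow0 2 (walk n) x = walk n x ^+ 2.
  by rewrite /pow0; case: eqP => [->|//]; rewrite expr0n.
move=> hP; rewrite 2!inE => /orP[/eqP ->|/orP[/eqP ->|]]; first exact: almost_invariant_supp.
- move: hP; rewrite !inE => /orP[]/eqP ->.
  + have [rho h] := energy_bound_entropy mu1; exists rho.
    apply: energy_bound_inv1 h _ => [|n x]; first exact: sqrtr0.
    by rewrite p1E sqr_sqrtr// walk_ge0.
  + have [|rho h] := @energy_bound_exp _ _ _ mu1 id _ 0 (dominates_sqr R).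
      by move=> x; rewrite expr1.
    by exists rho; exact: energy_bound_inv2 h _.
- rewrite inE => /eqP ->; move: hP; rewrite !inE => /orP[]/eqP ->.
  + have [|rho h] := @energy_bound_exp _ _ _ mu1 id _ 0 (dominates_sqr R).
      by move=> x; rewrite expr1.
    by exists rho; exact: energy_bound_inv1 h _.
  + have [|rho h] := @energy_bound_exp _ _ _ mu1 _ _ 1 (dominates_exp4 R) => //.
    by exists rho; exact: energy_bound_inv2 h _.
Qed.

End Slow.

(** * Norms and direct products *)

Section LpNorm.
Context (R : realType) (G : groupType) (p : R) (p1 : (1 <= p%:E)%E).
Implicit Types v w : lp G p1.

Lemma lp_normX (P : nat) v : (0 < P)%N -> p = P%:R -> finsupp (v : G -> R) ->
  `|v| ^+ P = gsum (fun x : G => `|v x| ^+ P).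
Proof.
move=> P0 pP fv; rewrite (@lp_norm_fin _ _ _ _ v _ fv); last first.
  by move=> x; apply: contra_notP => /eqP.
set s := (\sum_(x \in _) _).
have s0 : 0 <= s by apply: fsumr_ge0 => // x _; exact: powR_ge0.
rewrite -powR_mulrn ?powR_ge0// -powRrM -pP mulVf ?powRr1//; last first.
  by rewrite pP pnatr_eq0 -lt0n.
rewrite /gsum /s.
transitivity (\sum_(x \in [set x | v x != 0]) `|v x| ^+ P).
  by apply: eq_fsbigr => x _; rewrite -powR_mulrn// -pP.
apply: fsbig_widen => // x [_ /= xv]; apply/eqP; move: xv => /negP.
by rewrite negbK => /eqP ->; rewrite normr0 expr0n -[P == _]negbK -lt0n P0.
Qed.

Lemma translateBE g v x : (v - translate g v) x = v x - v (g^-1 * x)%g.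
Proof. by []. Qed.

Lemma norm_subr_translateM v g h :
  `|v - translate (g * h)%g v| <= `|v - translate g v| + `|v - translate h v|.
Proof.
rewrite translateM -[X in `|X|](subrKA (translate g v)).
by rewrite (le_trans (ler_normD _ _))// lerD2l -translateB norm_translate.
Qed.

Lemma norm_subr_translateV v g : `|v - translate g^-1%g v| = `|v - translate g v|.
Proof.
by rewrite -(norm_translate g) translateB -translateM mulgV translate1 distrC.
Qed.
End LpNorm.

(** If all five generators failed, each variation of [f ^+ P] would be at most [c / 8] times the
    mass: for [P = 2], [gsum_sqr_diff] at [eta = c / 20] gives [c / 10 + c / 40]. The total
    [5 c / 8] is below [c]. *)
Lemma variation_lower (R : realType) (G : groupType) (S : seq G) (c : R) (P : nat)
    (f : G -> R) : P \in [:: 1; 2]%N -> size S = 5 -> 0 < c -> finsupp f ->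
    (forall x, 0 <= f x) ->
    c * gsum (fun x => f x ^+ P) <=
      \sum_(s <- S) gsum (fun x => `|f x ^+ P - f (s^-1 * x)%g ^+ P|) ->
  exists2 s, s \in S & (c / 20) ^+ P * gsum (fun x => `|f x| ^+ P) <=
    gsum (fun x => `|f x - f (s^-1 * x)%g| ^+ P).
Proof.
move=> hP S5 c0 ff f0 hS; apply: contrapT => nh.
have P0 : (0 < P)%N by move: hP; rewrite !inE => /orP[]/eqP ->.
have fE : gsum (fun x => f x ^+ P) = gsum (fun x => `|f x| ^+ P).
  by apply: eq_gsum => x; rewrite ger0_norm.
rewrite fE in hS.
set M := gsum (fun x => `|f x| ^+ P) in hS nh.
have lt s : s \in S -> gsum (fun x => `|f x - f (s^-1 * x)%g| ^+ P) < (c / 20) ^+ P * M.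
  by move=> sS; rewrite ltNge; apply/negP => h; apply: nh; exists s.
have M0 : 0 < M.
  case: S S5 lt {hS nh} => // s S _ /(_ s (mem_head _ _)) h.
  have : 0 < (c / 20) ^+ P * M.
    by apply: le_lt_trans h; apply: gsum_ge0 => x; exact: exprn_ge0.
  by rewrite pmulr_rgt0// exprn_gt0// divr_gt0.
have hs s : s \in S -> gsum (fun x => `|f x ^+ P - f (s^-1 * x)%g ^+ P|) <= c / 8 * M.
  move=> /lt; move: hP M0 {lt nh hS}; rewrite /M !inE => /orP[]/eqP -> M0.
    under [X in X < _]eq_gsum do rewrite expr1.
    rewrite expr1 => /ltW h; under eq_gsum do rewrite !expr1.
    apply: le_trans h _; rewrite ler_wpM2r//; lra.
  move=> h.
  have c20 : 0 < c / 20 by rewrite divr_gt0.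
  apply: le_trans (gsum_sqr_diff s ff c20) _.
  have -> : gsum (fun x => f x ^+ 2) = gsum (fun x => `|f x| ^+ 2).
    by apply: eq_gsum => x; rewrite ger0_norm.
  have -> : gsum (fun x => (f x - f (s^-1 * x)%g) ^+ 2) =
      gsum (fun x => `|f x - f (s^-1 * x)%g| ^+ 2).
    by apply: eq_gsum => x; rewrite real_normK ?num_real.
  set M2 := gsum _ in M0 h *; set E := gsum _ in h *.
  have : (2 * (c / 20))^-1 * E <= (2 * (c / 20))^-1 * ((c / 20) ^+ 2 * M2).
    by rewrite ler_wpM2l ?invr_ge0 ?ltW// mulr_gt0.
  have -> : (2 * (c / 20))^-1 * ((c / 20) ^+ 2 * M2) = c / 40 * M2.
    by field; rewrite gt_eqF.
  lra.
have : c * M <= \sum_(s <- S) c / 8 * M.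
  by apply: le_trans hS _; rewrite big_seq [leRHS]big_seq; apply: ler_sum.
rewrite big_const_seq count_predT S5 iter_addr_0 -mulr_natl.
have : 0 < c * M by exact: mulr_gt0.
lra.
Qed.

(** * Sums and walks on direct products *)

Section Product.
Context (R : realType) (I : finType) (G : I -> groupType).

Lemma gsum_prod (u : forall i, G i -> R) : (forall i, finsupp (u i)) ->
  finsupp (fun g : prod_group G => \prod_i u i (g i)) /\
  gsum (fun g : prod_group G => \prod_i u i (g i)) = \prod_i gsum (u i).
Proof.
move=> fu; pose s i : seq (G i) := fset_set [set x | u i x != 0].
have us i : uniq (s i) by exact: fset_uniq.
have memS i x : (x \in s i) = (u i x != 0).
  by rewrite /s in_fset_set ?mem_setE//; exact: fu.
pose N := (\max_i size (s i)).+1.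
pose phi (k : {ffun I -> 'I_N}) : prod_group G := [ffun i => nth 1%g (s i) (k i)].
pose Q i (k : 'I_N) := (k < size (s i))%N.
pose L := [seq phi k | k <- enum (family Q)].
have supE (g : prod_group G) : \prod_i u i (g i) != 0 -> g \in L.
  move=> /prodf_neq0 g0.
  have lt i : (index (g i) (s i) < N)%N.
    by rewrite ltnS (leq_trans (index_size _ _))// (leq_bigmax i).
  apply/mapP; exists [ffun i => Ordinal (lt i)].
    rewrite mem_enum; apply/familyP => i.
    by rewrite ffunE unfold_in /Q /= index_mem memS g0.
  by apply/ffunP => i; rewrite !ffunE /= nth_index// memS g0.
have uL : uniq L.
  rewrite map_inj_in_uniq ?enum_uniq// => k l; rewrite !mem_enum.
  move=> /familyP kQ /familyP lQ /ffunP kl; apply/ffunP => i; apply/val_inj/eqP.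
  have := kl i; rewrite !ffunE => /eqP; rewrite nth_uniq//; [exact: kQ|exact: lQ].
split; first by apply/finsuppP; exists L.
rewrite (gsumE uL supE) big_map big_enum_cond/= (eq_bigl [in family Q]); last first.
  by move=> k; rewrite andbT.
transitivity (\prod_i \sum_(k < N | Q i k) u i (nth 1%g (s i) k)).
  rewrite bigA_distr_big_dep; apply: eq_bigr => k _.
  by apply: eq_bigr => i _; rewrite ffunE.
apply: eq_bigr => i _; rewrite (gsumE (us i)); last by move=> x; rewrite memS.
rewrite [RHS](big_nth 1%g) big_mkord.
by rewrite (big_ord_widen_cond N xpredT (fun k => u i (nth 1%g (s i) k))) //
  leqW// (leq_bigmax i).
Qed.

Definition inj_prod i (h : G i) : prod_group G := finfun (dfwith (fun l => 1%g : G l) i h).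

Lemma inj_prodE i (h : G i) : inj_prod h i = h.
Proof. by rewrite ffunE dfwithin. Qed.

Lemma inj_prodNE i l (h : G i) : i != l -> inj_prod h l = 1%g.
Proof. by move=> il; rewrite ffunE dfwithout. Qed.

Lemma inj_prod1 i : inj_prod (1%g : G i) = 1%g.
Proof.
apply/ffunP => l; rewrite [RHS]ffunE; have [il|il] := eqVneq i l; last exact: inj_prodNE.
by move: il => <-; rewrite inj_prodE.
Qed.

Lemma inj_prodM i (g h : G i) : inj_prod (g * h)%g = (inj_prod g * inj_prod h)%g.
Proof.
apply/ffunP => l; rewrite prod_groupME; have [il|il] := eqVneq i l.
  by move: il => <-; rewrite !inj_prodE.
by rewrite !inj_prodNE// mulg1.
Qed.

Lemma inj_prodV i (g : G i) : inj_prod g^-1%g = (inj_prod g)^-1%g.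
Proof.
apply/ffunP => l; rewrite prod_groupVE; have [il|il] := eqVneq i l.
  by move: il => <-; rewrite !inj_prodE.
by rewrite !inj_prodNE// invg1.
Qed.

(** The coordinates of [g] other than [j] are multiplied in one at a time; [part r] keeps those in
    [r]. *)
Lemma prod_group_gen (H : prod_group G -> Prop) (j : I) : H 1%g ->
  (forall g h, H g -> H h -> H (g * h)%g) ->
  (forall i (h : G i), i != j -> H (inj_prod h)) ->
  forall g : prod_group G, g j = 1%g -> H g.
Proof.
move=> H1 HM Hi g gj.
pose part (r : seq I) : prod_group G := [ffun l => if l \in r then g l else 1%g].
suff Hp (r : seq I) : uniq r -> H (part r).
  rewrite (_ : g = part (enum I)); first exact/Hp/enum_uniq.
  by apply/ffunP => l; rewrite ffunE mem_enum.
elim: r => [_|i r IHr /= /andP[ir ur]].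
  by rewrite (_ : part [::] = 1%g)//; apply/ffunP => l; rewrite !ffunE.
have [ij|ij] := eqVneq i j.
  rewrite (_ : part (i :: r) = part r); first exact: IHr.
  apply/ffunP => l; rewrite !ffunE inE; have [->|//] := eqVneq l i.
  by rewrite ij gj; case: ifP.
rewrite (_ : part (i :: r) = inj_prod (g i) * part r)%g; last first.
  apply/ffunP => l; rewrite prod_groupME [in RHS]ffunE [in RHS]ffunE [LHS]ffunE inE.
  have [->|li] := eqVneq l i; first by rewrite dfwithin /= (negbTE ir) mulg1.
  by rewrite dfwithout 1?eq_sym//= mul1g.
by apply: HM; [exact: Hi|exact: IHr].
Qed.

Context (mu : forall i, finprob R (G i)).

Lemma prod_walk n (g : prod_group G) :
  walk (prod_prob mu) n g = \prod_i walk (mu i) n (g i).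
Proof.
elim: n g => [|n IHn] g.
  rewrite /walk /=; have [->|g1] := eqVneq g 1%g.
    by rewrite big1// => i _; rewrite prod_group1E eqxx.
  have [i gi] : exists i, g i != 1%g.
    apply: contrapT => h; move/eqP: g1; apply; apply/ffunP => i.
    by rewrite prod_group1E; have [//|gi] := eqVneq (g i) 1%g; case: h; exists i.
  by rewrite (bigD1 i)//= (negbTE gi) mul0r.
rewrite walkS /convolution.
transitivity (gsum (fun y : prod_group G =>
    \prod_i (mu i (y i) * walk (mu i) n ((y i)^-1 * g i)%g))).
  apply: eq_gsum => y; rewrite IHn -big_split /=; apply: eq_bigr => i _.
  by rewrite prod_groupME prod_groupVE.
have [|_ ->] := @gsum_prod (fun i y => mu i y * walk (mu i) n (y^-1 * g i)%g) => //.
by move=> i; apply: finsupp_sub (pmf_fin (mu i) : finsupp (mu i)) => x ->; rewrite mul0r.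
Qed.

Lemma pow0_prod q (a : forall i, G i -> R) (g : prod_group G) :
  pow0 q (fun x : prod_group G => \prod_i a i (x i)) g = \prod_i pow0 q (a i) (g i).
Proof.
rewrite /pow0; case: ifPn => [|/prodf_neq0 h].
  by rewrite prodf_seq_eq0 => /hasP[i _ /= ai]; rewrite (bigD1 i)//= ai mul0r.
by rewrite -prodrXl; apply: eq_bigr => i _; rewrite (negbTE (h i isT)).
Qed.

(** Together with [gsum_prod_norm] it shows that the relative displacement by an element of one
    factor is computed in that factor. *)
Lemma gsum_prod_translate (P : nat) (f : forall i, G i -> R) i (h : G i) :
  (0 < P)%N -> (forall l, finsupp (f l)) ->
  gsum (fun g : prod_group G => `|\prod_l f l (g l) -
      \prod_l f l (((inj_prod h)^-1 * g)%g l)| ^+ P) =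
  gsum (fun x => `|f i x - f i (h^-1 * x)%g| ^+ P) *
    \prod_(l | l != i) gsum (fun x => `|f l x| ^+ P).
Proof.
move=> P0 ff.
pose u l x := f l x - (l == i)%:R * f l ((inj_prod h l)^-1 * x)%g.
have ui x : u i x = f i x - f i (h^-1 * x)%g by rewrite /u eqxx mul1r inj_prodE.
have ul l x : l != i -> u l x = f l x by move=> /negbTE li; rewrite /u li mul0r subr0.
have fexp (T : groupType) (v : T -> R) : finsupp v -> finsupp (fun x => `|v x| ^+ P).
  by apply: finsupp_sub => x ->; rewrite normr0 expr0n -[P == _]negbK -lt0n P0.
have [|_ uE] := @gsum_prod (fun l x => `|u l x| ^+ P).
  move=> l; apply: fexp; apply: finsuppB => //.
  apply: finsupp_sub (finsupp_translate (inj_prod h l)^-1%g (ff l)) => x ->.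
  by rewrite mulr0.
transitivity (gsum (fun g : prod_group G => \prod_l `|u l (g l)| ^+ P)).
  apply: eq_gsum => g; rewrite prodrXl -normr_prod; congr (`|_| ^+ _).
  rewrite !(bigD1 i (P := xpredT))//= ui.
  rewrite [in X in _ - X]prod_groupME prod_groupVE inj_prodE mulrBl; congr (_ * _ - _ * _).
    by apply: eq_bigr => l li; rewrite ul.
  apply: eq_bigr => l li; rewrite ul// prod_groupME prod_groupVE.
  by rewrite inj_prodNE 1?eq_sym// invg1 mul1g.
rewrite uE (bigD1 i)//=; congr (_ * _); first by apply: eq_gsum => x; rewrite ui.
by apply: eq_bigr => l li; apply: eq_gsum => x; rewrite ul.
Qed.

Lemma gsum_prod_norm (P : nat) (f : forall i, G i -> R) :
  (0 < P)%N -> (forall l, finsupp (f l)) ->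
  gsum (fun g : prod_group G => `|\prod_l f l (g l)| ^+ P) =
    \prod_l gsum (fun x => `|f l x| ^+ P).
Proof.
move=> P0 ff; have [|_ <-] := @gsum_prod (fun l x => `|f l x| ^+ P).
  move=> l; apply: finsupp_sub (ff l) => x ->.
  by rewrite normr0 expr0n -[P == _]negbK -lt0n P0.
by apply: eq_gsum => g; rewrite prodrXl normr_prod.
Qed.

End Product.

(** * Random walks at the time scales *)

Section Stages.
Context (R : realType) (D : nat) (Xs : nat -> nat -> kaction) (c : nat -> R)
  (N : nat -> nat).

(** The denominator makes it negligible against [c k]; the minimum keeps it at most 1, as
    [almost_invariant] requires. *)
Definition stage_eps (k : nat) (x : R) : R := Num.min x 1 / k.+1%:R.
(** The square matches the threshold [eta ^+ 2]; the extra [k + 1] beats constants depending on the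
    measures, which come after the groups. *)
Definition stage_rate (k : nat) (x : R) : R := stage_eps k x ^+ 2 / k.+1%:R.

Lemma stage_eps_gt0 k x : 0 < x -> 0 < stage_eps k x.
Proof. by move=> x0; rewrite divr_gt0// lt_min x0 ltr01. Qed.

Lemma stage_rate_gt0 k x : 0 < x -> 0 < stage_rate k x.
Proof. by move=> x0; rewrite divr_gt0// exprn_gt0// stage_eps_gt0. Qed.

Lemma stage_eps_le1 k x : stage_eps k x <= 1.
Proof. by rewrite ler_pdivrMr// mul1r ge_min; apply/orP; right; rewrite ler1n. Qed.

Hypothesis c_gt0 : forall k, 0 < c k.
Hypothesis N_ge : forall k, (2 * k <= N k)%N.
Hypothesis isoper : forall j k, (k %% D)%N = j -> forall F : diag (Xs j) -> R,
  (forall g, 0 <= F g) -> finsupp F -> (forall g, F g != 0 -> wball (k * N k) g) ->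
  c k * gsum F <= \sum_(s <- gens (Xs j)) gsum (fun x => `|F x - F (s^-1 * x)%g|).
Hypothesis slow : forall j k, (k %% D)%N <> j -> exists2 T : seq (diag (Xs j)),
  (size T)%:R <= expR (stage_rate k (c k) * (N k)%:R) &
  forall g, wball (k * N k) g -> g \in T.

Local Notation G := (fun i : 'I_D => diag (Xs i) : groupType).
Context (mu : forall i, finprob R (G i)) (P q : nat).
Hypothesis mu1 : forall i, 0 < mu i 1%g.
Hypotheses (hP : P \in [:: 1; 2]%N) (hq : q \in [:: 0; 1; 2]%N).

Let F i n : G i -> R := pow0 q (walk (mu i) n).
Arguments F : clear implicits.

Let finF i n : finsupp (F i n).
Proof. exact/pow0_fin/finsupp_walk. Qed.

Let F_ge0 i n x : 0 <= F i n x.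
Proof. by rewrite /F /pow0; case: ifP => // _; rewrite exprn_ge0// walk_ge0. Qed.

Let P0 : (0 < P)%N. Proof. by move: hP; rewrite !inE => /orP[]/eqP ->. Qed.

Lemma mu_ball : exists l, forall i x, mu i x != 0 -> wball l x.
Proof.
have /choice[l lP] : forall i, exists l, forall x, mu i x != 0 -> wball l x.
  move=> i; have [s _ sf] := finsupp_list (pmf_fin (mu i) : finsupp (mu i)).
  suff [l hl] : exists l, forall x, x \in s -> wball l x.
    by exists l => x; rewrite -sf; exact: hl.
  elim: s {sf} => [|y s [l hl]]; first by exists 0%N.
  have [m hm] := wballT y; exists (m + l)%N => x; rewrite inE => /predU1P[->|/hl].
    by apply: wball_leq hm; exact: leq_addr.
  by apply: wball_leq; exact: leq_addl.
exists (\max_i l i) => i x /lP; apply: wball_leq; exact: leq_bigmax.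
Qed.

(** The factor [k] in the radius absorbs the step length [l] of measures unknown when the groups are
    built. *)
Lemma walk_ball l : (forall i x, mu i x != 0 -> wball l x) ->
  forall k i n x, (l <= k)%N -> (n <= N k)%N -> walk (mu i) n x != 0 ->
  wball (k * N k) x.
Proof.
move=> hl k i n x lk nN /(walk_supp (B := @wball (Xs i))) h.
have : wball (n * l) x.
  apply: h => //; [exact: wball1|move=> *; exact: wballM|exact: hl].
by apply: wball_leq; rewrite mulnC leq_mul.
Qed.

Lemma stage_lower (j : 'I_D) k n l : (forall i x, mu i x != 0 -> wball l x) ->
  (l <= k)%N -> (k %% D)%N = j -> (n <= N k)%N ->
  exists2 s, s \in gens (Xs j) &
    (c k / 20) ^+ P * gsum (fun x => `|F j n x| ^+ P) <=
    gsum (fun x => `|F j n x - F j n (s^-1 * x)%g| ^+ P).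
Proof.
move=> hl lk kj nN.
apply: variation_lower => //.
  by rewrite size_map -cardE card_option card_klein.
  exact: finF.
apply: (@isoper _ _ kj (fun x => F j n x ^+ P)).
- by move=> g; rewrite exprn_ge0// F_ge0.
- apply: finsupp_sub (finF j n) => x ->; by rewrite expr0n -[P == _]negbK -lt0n P0.
move=> g; rewrite expf_eq0 P0 /= => Fg; apply: (walk_ball hl lk nN (i := j)).
by apply: contra_neq Fg => wg; rewrite /F /pow0 wg eqxx.
Qed.

(** Averaging over [n] between [k] and [N k]: if the sum of the [rho i] were always at least
    [e ^+ 2], its total would be at least half of [e ^+ 2 * N k], more than slow growth allows.
    Summing over [i] first gives one time for all factors. *)
Lemma stage_upper (j : 'I_D) : exists k0, forall k, (k0 <= k)%N -> (k %% D)%N = j ->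
  exists2 n, (k <= n < N k)%N & forall i h, i != j -> mu i h != 0 ->
    gsum (fun x => `|F i n x - F i n (h^-1 * x)%g| ^+ P) <=
    (3 * stage_eps k (c k)) ^+ P * gsum (fun x => `|F i n x| ^+ P).
Proof.
have /choice[rho rhoP] : forall i, exists rho, almost_invariant (mu i) P q rho.
  by move=> i; exact: almost_invariant_ex.
have /choice[C CP] : forall i, exists C, 0 <= C /\ forall M (T : seq (G i)),
    (forall x, walk (mu i) M x != 0 -> x \in T) ->
    \sum_(0 <= n < M) rho i n <= C * ln (size T)%:R.
  by move=> i; have [_ [C C0 hC] _] := rhoP i; exists C.
have [l hl] := mu_ball.
pose CC := \sum_i C i.
have CC0 : 0 <= CC by apply: sumr_ge0 => i _; have [] := CP i.
pose k1 := Num.Def.archi_bound (2 * CC).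
have k1P : 2 * CC < k1%:R by rewrite archi_boundP// mulr_ge0.
(* [l] confines the walks to the ball, [k1] gives [CC / (k + 1) < 1 / 2], and 1 makes [N k]
   positive. *)
exists (maxn l (maxn k1 1)) => k; rewrite !geq_max => /andP[lk /andP[k1k k_gt0]] kj.
set e := stage_eps k (c k).
have e0 : 0 < e by exact: stage_eps_gt0.
apply: contrapT => nh.
have big_rho n : (k <= n < N k)%N -> e ^+ 2 <= \sum_(i | i != j) rho i n.
  move=> nk; apply: contrapT => /negP; rewrite -ltNge => small; apply: nh.
  exists n => // i h ij h0.
  have [r0 _ rI] := rhoP i; apply: rI => //.
    by rewrite e0 stage_eps_le1.
  apply: le_trans (ltW small); rewrite (bigD1 i)//= lerDl sumr_ge0// => i' _.
  by have [] := rhoP i'.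
have NN : (k <= N k)%N by have := N_ge k; lia.
have : (N k - k)%:R * e ^+ 2 <= CC * (stage_rate k (c k) * (N k)%:R).
  apply: (@le_trans _ _ (\sum_(k <= n < N k) \sum_(i | i != j) rho i n)).
    apply: (@le_trans _ _ (\sum_(k <= n < N k) e ^+ 2)).
      by rewrite sumr_const_nat mulr_natl.
    by apply: ler_sum_nat => n nk; exact: big_rho.
  apply: (@le_trans _ _ (\sum_(0 <= n < N k) \sum_(i | i != j) rho i n)).
    rewrite [leRHS](big_cat_nat (n := k))//= lerDr.
    by apply: sumr_ge0 => n _; apply: sumr_ge0 => i _; have [] := rhoP i.
  rewrite exchange_big /= /CC mulr_suml [leRHS](bigID (fun i => i != j))/=.
  rewrite -[leLHS]addr0; apply: lerD.
    apply: ler_sum => i ij; have [Ci hCi] := CP i.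
    have [|T Tsize hT] := @slow i k.
      by rewrite kj => /val_inj /eqP; rewrite eq_sym (negbTE ij).
    have supp x : walk (mu i) (N k) x != 0 -> x \in T.
      by move=> /(walk_ball hl lk (leqnn _)) /hT.
    apply: le_trans (hCi _ _ supp) _; rewrite ler_wpM2l//.
    rewrite -[leRHS]expRK ler_ln ?posrE ?expR_gt0//.
    by rewrite ltr0n (size_supp_gt0 supp).
  apply: sumr_ge0 => i _; rewrite mulr_ge0//; first by have [] := CP i.
  by rewrite mulr_ge0// ltW// stage_rate_gt0.
rewrite /stage_rate -/e natrB//.
have N2k : 2 * k%:R <= (N k)%:R :> R by rewrite -natrM ler_nat.
have k0 : 1 <= k%:R :> R by rewrite ler1n.
have k1k' : k1%:R <= k%:R :> R by rewrite ler_nat.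
have e2 : 0 < e ^+ 2 by exact: exprn_gt0.
rewrite [leRHS](_ : _ = CC / k.+1%:R * (N k)%:R * e ^+ 2); last first.
  by field; rewrite addrC natr1 pnatr_eq0.
rewrite ler_pM2r// => h.
have hlt : CC / k.+1%:R < 1 / 2.
  by rewrite ltr_pdivrMr// -[k.+1%:R]natr1; lra.
have : CC / k.+1%:R * (N k)%:R < 1 / 2 * (N k)%:R by rewrite ltr_pM2r//; lra.
move: h; set X := CC / _ * _ => h h'.
by move: h h' N2k k0; lra.
Qed.

End Stages.

(** In a finite group some ball of radius [k N k] is everything, and the constant 1, of zero
    variation, violates the isoperimetric inequality. *)
Lemma diag_infinite (R : realType) (Xs : nat -> kaction) (c : nat -> R) (N : nat -> nat)
    (K : set nat) :
  (forall n, exists2 k, K k & (n <= k * N k)%N) -> (forall k, 0 < c k) ->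
  (forall k, K k -> forall F : diag Xs -> R,
    (forall g, 0 <= F g) -> finsupp F -> (forall g, F g != 0 -> wball (k * N k) g) ->
    c k * gsum F <= \sum_(s <- gens Xs) gsum (fun x => `|F x - F (s^-1 * x)%g|)) ->
  infinite_set [set: diag Xs].
Proof.
move=> KN c0 isoper fin.
have [n hn] : exists n, forall g : diag Xs, wball n g.
  have [s us sT] : exists2 s : seq (diag Xs), uniq s & forall x, x \in s.
    exists (fset_set [set: diag Xs]); first exact: fset_uniq.
    by move=> x; rewrite in_fset_set ?in_setT.
  suff [n hn] : exists n, forall g, g \in s -> wball n g by exists n => g; exact: hn.
  elim: s {us sT} => [|y s [l hl]]; first by exists 0%N.
  have [m hm] := wballT y; exists (m + l)%N => x; rewrite inE => /predU1P[->|/hl].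
    by apply: wball_leq hm; exact: leq_addr.
  by apply: wball_leq; exact: leq_addl.
have [k Kk nk] := KN n.
have f1 : @finsupp R (diag Xs) (fun=> 1) by rewrite /finsupp; apply: sub_finite_set fin => x _.
have := isoper k Kk (fun=> 1) (fun=> ler01) f1 (fun g _ => wball_leq nk (hn g)).
rewrite big1; last first.
  by move=> s _; rewrite -[RHS](gsum0 R (diag Xs)); apply: eq_gsum => x; rewrite subrr normr0.
by rewrite pmulr_rle0// leNgt (@gsum_gt0 _ _ _ 1%g).
Qed.

(** * Displacements in the product group *)

Section ProductWalk.
Context (R : realType) (p : R) (p1 : (1 <= p%:E)%E) (P q : nat).
Hypotheses (P0 : (0 < P)%N) (pP : p = P%:R).
Context (I : finType) (G : I -> groupType) (mu : forall i, finprob R (G i)).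
Let v n : lp (prod_group G) p1 := convolution_powq p1 q (prod_prob mu) n.
Let F i n : G i -> R := pow0 q (walk (mu i) n).
Arguments F : clear implicits.

Let finF i n : finsupp (F i n).
Proof. exact/pow0_fin/finsupp_walk. Qed.

Let vE n (x : prod_group G) : v n x = \prod_i F i n (x i).
Proof.
rewrite /v /convolution_powq lp_finE -pow0_prod; congr (pow0 q _ x).
by apply/funext => g; exact: prod_walk.
Qed.

Let finv n : finsupp (v n : prod_group G -> R).
Proof.
have [f _] := gsum_prod (fun i => finF i n).
by apply: finsupp_sub f => x fx; rewrite -fx vE.
Qed.

Let normv n : `|v n| ^+ P = \prod_i gsum (fun x => `|F i n x| ^+ P).
Proof.
rewrite (lp_normX P0 pP (finv n)) -(gsum_prod_norm P0 (fun i => finF i n)).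
by apply: eq_gsum => x; rewrite vE.
Qed.

Let normv_translate n i (h : G i) : `|v n - translate (inj_prod h) (v n)| ^+ P =
  gsum (fun x => `|F i n x - F i n (h^-1 * x)%g| ^+ P) *
    \prod_(l | l != i) gsum (fun x => `|F l n x| ^+ P).
Proof.
rewrite (lp_normX P0 pP); last first.
  apply: (finsuppB (finv n)); exact: (finsupp_translate (inj_prod h)^-1%g (finv n)).
rewrite -(gsum_prod_translate h P0 (fun i => finF i n)).
by apply: eq_gsum => x; rewrite translateBE !vE.
Qed.

Let lerP (a b : R) : 0 <= a -> 0 <= b -> a ^+ P <= b ^+ P -> a <= b.
Proof. by move=> a0 b0; rewrite ler_pXn2r// nnegrE. Qed.

Let prodN_ge0 n i : 0 <= \prod_(l | l != i) gsum (fun x => `|F l n x| ^+ P).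
Proof.
by apply: prodr_ge0 => l _; apply: gsum_ge0 => x; exact: exprn_ge0.
Qed.

Lemma prod_translate_le n i (h : G i) (k : R) : 0 <= k ->
  gsum (fun x => `|F i n x - F i n (h^-1 * x)%g| ^+ P) <=
    k ^+ P * gsum (fun x => `|F i n x| ^+ P) ->
  `|v n - translate (inj_prod h) (v n)| <= k * `|v n|.
Proof.
move=> k0 hk; apply: lerP => //; first exact: mulr_ge0.
rewrite exprMn normv normv_translate [in leRHS](bigD1 i)//= mulrA.
exact: ler_wpM2r.
Qed.

Lemma prod_translate_ge n i (h : G i) (k : R) : 0 <= k ->
  k ^+ P * gsum (fun x => `|F i n x| ^+ P) <=
    gsum (fun x => `|F i n x - F i n (h^-1 * x)%g| ^+ P) ->
  k * `|v n| <= `|v n - translate (inj_prod h) (v n)|.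
Proof.
move=> k0 hk; apply: lerP => //; first exact: mulr_ge0.
rewrite exprMn normv normv_translate [in leLHS](bigD1 i)//= mulrA.
exact: ler_wpM2r.
Qed.

(** Displacement is subadditive and [g] is a product of support elements of the other factors and
    their inverses. The point is that [M] is independent of [n]. *)
Lemma translate_generated (j : I) : (forall i, nondegenerate_prob (mu i)) ->
  forall g : prod_group G, g j = 1%g ->
  exists2 M, 0 <= M & forall n (e : R), 0 <= e ->
    (forall i h, i != j -> mu i h != 0 -> `|v n - translate (inj_prod h) (v n)| <= e) ->
    `|v n - translate g (v n)| <= M * e.
Proof.
move=> nd.
pose Q (g : prod_group G) := exists2 M, 0 <= M & forall n (e : R), 0 <= e ->
    (forall i h, i != j -> mu i h != 0 -> `|v n - translate (inj_prod h) (v n)| <= e) ->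
    `|v n - translate g (v n)| <= M * e.
have Q1 : Q 1%g by exists 0 => // n e e0 _; rewrite translate1 subrr normr0 mul0r.
have QM g h : Q g -> Q h -> Q (g * h)%g.
  move=> [M M0 hM] [M' M'0 hM']; exists (M + M'); first exact: addr_ge0.
  move=> n e e0 he; apply: le_trans (norm_subr_translateM _ _ _) _.
  by rewrite mulrDl lerD ?hM ?hM'.
have QV g : Q g -> Q g^-1%g.
  by move=> [M M0 hM]; exists M => // n e e0 he; rewrite norm_subr_translateV hM.
apply: prod_group_gen => // i h ij.
have /asboolP// : h \in [pred x | `[< Q (inj_prod x) >]].
apply: (nd i) => [|x x0]; last first.
  apply/asboolP; exists 1 => // n e e0 he; rewrite mul1r; exact: he.
split; first by apply/asboolP; rewrite inj_prod1.
move=> x y /asboolP Qx /asboolP Qy; apply/asboolP.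
by rewrite inj_prodM inj_prodV; apply: QM => //; exact: QV.
Qed.

End ProductWalk.

(** * The ultrafilter and the limiting cocycle *)

Lemma ultrafilter_of_seq (n_ : nat -> nat) : (forall t, (t <= n_ t)%N) ->
  exists U : set_system nat, [/\ UltraFilter U, nonprincipal U &
    forall A : set nat, (\forall t \near \oo, A (n_ t)) -> U A].
Proof.
move=> n_ge; have [U [UU FU]] := ultraFilterLemma (fmap_proper_filter n_ (@eventually_filter)).
exists U; split=> // x Ux.
(* The times [n_ t >= t] eventually leave every point. *)
have /FU Un : (n_ @ \oo) (~` [set x]).
  exists x.+1 => // t /= xt tx; have := n_ge t; rewrite tx; lia.
apply: (filter_not_empty U); rewrite -(setICr [set x]); exact: filterI.
Qed.

Theorem theorem3 (R : realType) (p : R) (p1 : (1 <= p%:E)%E)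
    (hp : p = 1 \/ p = 2) (q : nat) (hq : q \in [:: 0; 1; 2]%N)
    (D : nat) (hD : (2 <= D)%N) :
  exists G : 'I_D -> groupType,
    (forall i, finitely_generated (G i)) /\
    (forall i, torsion (G i)) /\
    infinite_set [set: prod_group G] /\
    forall mu : forall i : 'I_D, finprob R (G i),
      (forall i, symmetric_prob (mu i)) ->
      (forall i, nondegenerate_prob (mu i)) ->
      (forall i, 0 < mu i 1%g) ->
      forall j : 'I_D,
      exists (U : set_system nat) (UU : UltraFilter U),
        nonprincipal U /\
        forall (S : seq (prod_group G)) (genS : generates [in S]),
          factors_through
            (limit_cocycle p1 q (prod_prob mu) genS U)
            (fun g : prod_group G => g j).
Proof.
have [P hP pP] : exists2 P : nat, P \in [:: 1; 2]%N & p = P%:R.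
  by case: hp => ->; [exists 1%N|exists 2].
have P0 : (0 < P)%N by move: hP; rewrite !inE => /orP[]/eqP ->.
have D0 : (0 < D)%N by exact: leq_trans hD.
have modD (j : 'I_D) t : ((j + D * t) %% D = j)%N.
  by rewrite addnC mulnC modnMDl modn_small.
have [Xs [c [N [c0 N2 tors iso slow]]]] :=
  oscillating_groups D (fun k x => @stage_rate_gt0 R k x).
exists (fun i => diag (Xs i)); split; [|split; [|split]].
- by move=> i; exists (gens (Xs i)); exact: diag_generates.
- by move=> i; exact: tors.
- pose j0 : 'I_D := Ordinal D0.
  have inf : infinite_set [set: diag (Xs j0)].
    apply: (@diag_infinite R (Xs j0) c N [set k | (k %% D)%N = j0]) => //.
      move=> n; exists (D * n.+1)%N; first by rewrite /= mulnC modnMl.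
      have := N2 (D * n.+1)%N; have : (n < D * n.+1)%N by rewrite leq_pmull.
      by nia.
    by move=> k kj; exact: iso.
  move=> fin; apply: inf.
  have := finite_image (fun g : prod_group (fun i : 'I_D => diag (Xs i)) => g j0) fin.
  apply: sub_finite_set => g _ /=.
  by exists (@inj_prod _ (fun i : 'I_D => diag (Xs i)) j0 g) => //; rewrite inj_prodE.
move=> mu _ nd mu1 j.
pose v n := convolution_powq p1 q (prod_prob mu) n.
pose inj j s := @inj_prod _ (fun i : 'I_D => diag (Xs i)) j s.
have [k0 k0P] := stage_upper c0 N2 slow mu1 hP hq j.
have [l hl] := mu_ball mu.
pose k t := (j + D * t)%N.
pose good t n := forall i h, i != j -> mu i h != 0 ->
    `|v n - translate (inj_prod h) (v n)| <= 3 * stage_eps (k t) (c (k t)) * `|v n|.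
pose low t n := exists2 s, s \in gens (Xs j) &
    c (k t) / 20 * `|v n| <= `|v n - translate (inj j s) (v n)|.
(* The stages [k t] are those of factor [j]. For small [t] the value is a placeholder, which the
   ultrafilter ignores. *)
have /choice[n_ n_P] : forall t, exists n, (t <= n)%N /\
    ((maxn k0 l <= t)%N -> good t n /\ low t n).
  move=> t; have tk : (t <= k t)%N by rewrite /k; nia.
  have [tl|] := leqP (maxn k0 l) t; last by exists t.
  move: tl; rewrite geq_max => /andP[k0t lt].
  have [n /andP[kn nN] hn] := k0P (k t) (leq_trans k0t tk) (modD j t).
  exists n; split; [exact: leq_trans kn|move=> _; split].
    move=> i h ij h0; apply: (prod_translate_le p1 P0 pP).
      by rewrite mulr_ge0// ltW// stage_eps_gt0.
    exact: hn.
  have [s sg hs] := stage_lower c0 iso q hP hl (leq_trans lt tk) (modD j t) (ltnW nN).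
  exists s => //; apply: (prod_translate_ge p1 P0 pP) => //.
  by rewrite divr_ge0// ltW.
have [U [UU Unp UF]] := ultrafilter_of_seq (fun t => proj1 (n_P t)).
exists U, UU; split=> // S genS x y xy.
apply/ultraclass_eq.
(* If [alpha] vanishes then [a n] is 0, consistently with [cocycle_seq]. *)
pose a n := (alpha p1 q (prod_prob mu) S n)^-1.
have a0 n : 0 <= a n by rewrite /a invr_ge0; exact: alpha_ge0.
pose g := (x^-1 * y)%g.
have gj : g j = 1%g by rewrite prod_groupME prod_groupVE xy mulVg.
have [M M0 MP] := translate_generated p1 q nd gj.
(* The cocycle is bounded on the generators of factor [j]; combined with [low], this bounds [a n]
   times the norm of [v n] by [20 B / c (k t)] at the good times. *)
have [B B0 BP] : exists2 B, 0 <= B & forall n s, s \in gens (Xs j) ->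
    a n * `|v n - translate (inj j s) (v n)| <= B.
  elim: (gens (Xs j)) => [|s r [B B0 BP]]; first by exists 0.
  have := cocycle_seq_bounded p1 q (prod_prob mu) genS
    (inj j s).
  move=> /asboolP[B' hB']; exists (B + `|B'|); first exact: addr_ge0.
  move=> n s'; rewrite inE => /predU1P[->|/(BP n) h]; last first.
    by apply: le_trans h _; rewrite lerDl.
  have := hB' n; rewrite /cocycle_seq lp_normZ (ger0_norm (a0 n)) => h.
  apply: le_trans h _; apply: le_trans (ler_norm _) _; by rewrite lerDr.
(* The 60 is the product of the 3 in [good] and the 20 in [low]. *)
pose K := M * 60 * B.
have K0 : 0 <= K by rewrite !mulr_ge0.
have hK t : (maxn k0 l <= t)%N ->
    a (n_ t) * `|v (n_ t) - translate g (v (n_ t))| <= K / t.+1%:R.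
  move=> tl; have [_ /(_ tl)[gd [s sg hs]]] := n_P t.
  set n := n_ t in gd hs *.
  have e0 : 0 < stage_eps (k t) (c (k t)) by exact: stage_eps_gt0.
  have h1 : `|v n - translate g (v n)| <= M * (3 * stage_eps (k t) (c (k t)) * `|v n|).
    by apply: MP gd; apply: mulr_ge0 => //; apply: mulr_ge0 => //; exact: ltW.
  have ct := c0 (k t).
  have h2 : stage_eps (k t) (c (k t)) * `|v n| <= 20 * t.+1%:R^-1 *
      `|v n - translate (inj j s) (v n)|.
    apply: (@le_trans _ _ (20 * t.+1%:R^-1 * (c (k t) / 20 * `|v n|))); last first.
      by rewrite ler_wpM2l// mulr_ge0.
    rewrite !mulrA ler_wpM2r// /stage_eps.
    rewrite [leRHS](_ : _ = c (k t) * t.+1%:R^-1); last by field; rewrite addrC natr1 pnatr_eq0.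
    apply: ler_pM.
    - by rewrite le_min ler01 ltW.
    - by rewrite invr_ge0.
    - by rewrite ge_min lexx.
    - rewrite lef_pV2 ?posrE// ler_nat ltnS /k.
      by rewrite (leq_trans _ (leq_addl _ _))// leq_pmull.
  have h3 := BP n s sg.
  apply: (@le_trans _ _ (a n * (M * (3 * (20 * t.+1%:R^-1 *
      `|v n - translate (inj j s) (v n)|))))).
    rewrite ler_wpM2l//; apply: le_trans h1 _; rewrite ler_wpM2l// -mulrA.
    by rewrite ler_wpM2l.
  rewrite [leLHS](_ : _ = M * 60 * t.+1%:R^-1 * (a n *
    `|v n - translate (inj j s) (v n)|)); last by ring.
  rewrite /K [leRHS]mulrAC; apply: ler_wpM2l => //.
  by rewrite !mulr_ge0.
(* The difference of the values at [x] and [y] is, up to sign, the translate by [x] of the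
   displacement by [g]. *)
have normE n : `|cocycle_seq p1 q (prod_prob mu) S x n - cocycle_seq p1 q (prod_prob mu) S y n| =
    a n * `|v n - translate g (v n)|.
  rewrite /cocycle_seq -scalerBr lp_normZ (ger0_norm (a0 n)); congr (_ * _).
  rewrite opprD opprK addrACA subrr add0r addrC -[in RHS](norm_translate x).
  by rewrite translateB -translateM /g mulKVg distrC.
apply/cvgrPdist_le => e e0; apply: UF.
exists (maxn (maxn k0 l) (Num.Def.archi_bound (K / e))) => // t /=.
rewrite geq_max => /andP[tl te].
rewrite sub0r normrN normr_id normE; apply: le_trans (hK t tl) _.
rewrite ler_pdivrMr// mulrC -ler_pdivrMr//; apply/ltW.
apply: (@lt_le_trans _ _ (Num.Def.archi_bound (K / e))%:R).
  by rewrite archi_boundP// divr_ge0// ltW.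
by rewrite ler_nat; exact: leqW.
Qed.
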